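(* Let $L$ be a homogeneous Lévy basis on $\mathbb{R}^2$ with seed $L'$ satisfying $\mathbb E(|L'|^2)<\infty$, and let $X$ be (a measurable version of) the trawl process with trawl function $a$. Let $\Delta_n\downarrow0$ with $n\Delta_n\to\mu\in(0,\infty)$ as $n\to\infty$. Then for every $V>0$, $$\sup_{0\le t\le V}\left|\Delta_n\mathbf S^n_t-\int_0^{t\mu}\tilde X_s\,\mathrm ds\right|\ \overset{\mathbb P}{\rightarrow}\ 0 .$$
   Context: $[\cdot]$ denotes the integer part; $\mathbb{R}^+=[0,\infty)$; $\overset{\mathbb P}{\rightarrow}$ is convergence in probability as $n\to\infty$. Lévy basis. A homogeneous Lévy basis on $\mathbb{R}^2$ with characteristic triplet $(\gamma,b,\nu)$ ($\gamma\in\mathbb R$, $b\ge0$, $\nu$ a Lévy measure on $\mathbb R$) is a family $L=\{L(A)\}$ of real random variables, indexed by Borel sets $A\subset\mathbb{R}^2$ of finite Lebesgue measure, that is a.s. $\sigma$-additive, takes independent values on disjoint sets, and satisfies $\log\mathbb{E}e^{izL(A)}=\mathrm{Leb}(A)\psi(z)$ with $\psi(z)=i\gamma z-\frac12b^2z^2+\int_{\mathbb{R}\setminus\{0\}}(e^{izx}-1-izx\mathbf 1_{|x|\le1})\nu(\mathrm{d}x)$. The seed $L'$ is a random variable with $\log\mathbb{E}e^{izL'}=\psi(z)$. Trawl process. The trawl function $a:\mathbb{R}^+\to\mathbb{R}^+$ is non-increasing, integrable and continuous on $[0,\infty)$; $A=\{(r,y):r\le0,\ 0\le y\le a(-r)\}$,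 $A_t=A+(t,0)$, and $X_t=L(A_t)$, $t\in\mathbb R$. Write $\tilde X_t=X_t-\mathbb E(X_t)$ and $\mathbf S^n_t=\sum_{k=0}^{[nt]-1}\big(X_{k\Delta_n}-\mathbb{E}(X_{k\Delta_n})\big)$, $t\ge0$. *)

(* Defs.v *)
From HB Require Import structures.
From mathcomp Require Import all_boot all_order all_algebra.
From mathcomp Require Import complex.
From mathcomp Require Import all_classical all_reals all_analysis.
From mathcomp Require Import measurable_realfun.

Set Implicit Arguments.
Unset Strict Implicit.
Unset Printing Implicit Defensive.

Import Order.TTheory GRing.Theory Num.Theory.
Import numFieldTopology.Exports numFieldNormedType.Exports.

Local Open Scope classical_set_scope.
Local Open Scope ring_scope.
Local Open Scope complex_scope.

Definition cexp (R : realType) (u : R[i]) : R[i] :=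
  (expR (complex.Re u) * cos (complex.Im u)) +i* (expR (complex.Re u) * sin (complex.Im u)).

Definition cintegral (R : realType) (d : measure_display) (T : measurableType d)
    (m : {measure set T -> \bar R}) (D : set T) (f : T -> R[i]) : R[i] :=
  (\int[m]_(x in D) complex.Re (f x)) +i* (\int[m]_(x in D) complex.Im (f x)).

Definition char_fun (R : realType) (d : measure_display) (T : measurableType d)
    (P : probability T R) (Y : {RV P >-> R}) (z : R) : R[i] :=
  cintegral P setT (fun w => cexp ('i%C * (z * Y w)%:C)).

Definition levy_measure (R : realType) (nu : {measure set R -> \bar R}) : Prop :=
  nu [set 0] = 0%E /\ (\int[nu]_x (Num.min 1 (x ^+ 2))%:E < +oo)%E.

Definition levy_exponent (R : realType) (gamma b : R)
    (nu : {measure set R -> \bar R}) (z : R) : R[i] :=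
  'i%C * (gamma * z)%:C - (2^-1 * b ^+ 2 * z ^+ 2)%:C
  + cintegral nu (~` [set 0])
      (fun x => cexp ('i%C * (z * x)%:C) - 1
                - 'i%C * (z * x * \1_[set y : R | `|y| <= 1] x)%:C).

(* Applying the condition to [B i = setT] gives every subfamily. *)
Definition mutually_independent (R : realType) (d : measure_display)
    (T : measurableType d) (P : probability T R) (n : nat)
    (Y : 'I_n -> {RV P >-> R}) : Prop :=
  forall B : 'I_n -> set R, (forall i, measurable (B i)) ->
    P (\bigcap_(i in [set: 'I_n]) (Y i @^-1` B i)) =
    (\prod_(i < n) P (Y i @^-1` B i))%E.

Definition lebesgue2 (R : realType) : set (R * R) -> \bar R :=
  (@lebesgue_measure R \x @lebesgue_measure R)%E.

Definition borel_finite (R : realType) (A : set (R * R)) : Prop :=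
  measurable A /\ (lebesgue2 A < +oo)%E.

(* Only the values of [L] on Borel sets of finite measure are constrained.
   [log E e^{izL(A)} = Leb(A) psi(z)] is stated in exponential form, which needs
   no choice of branch. *)
Record levy_basis (R : realType) (d : measure_display) (T : measurableType d)
    (P : probability T R) (gamma b : R) (nu : {measure set R -> \bar R})
    (L : set (R * R) -> {RV P >-> R}) : Prop := LevyBasis {
  levy_basis_gaussian : 0 <= b ;
  levy_basis_levy_measure : levy_measure nu ;
  levy_basis_additive : forall A : nat -> set (R * R),
    (forall k, measurable (A k)) -> trivIset setT A ->
    borel_finite (\bigcup_k A k) ->
    {ae P, forall w,
      (fun n => \sum_(0 <= k < n) L (A k) w) @ \oo --> L (\bigcup_k A k) w} ;
  levy_basis_independent : forall (n : nat) (A : 'I_n -> set (R * R)),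
    (forall i, borel_finite (A i)) -> trivIset setT A ->
    mutually_independent (fun i => L (A i)) ;
  levy_basis_char_fun : forall (A : set (R * R)) (z : R), borel_finite A ->
    char_fun (L A) z =
    cexp ((fine (lebesgue2 A))%:C * levy_exponent gamma b nu z)
}.

Definition is_seed (R : realType) (gamma b : R) (nu : {measure set R -> \bar R})
    (d : measure_display) (T : measurableType d) (P : probability T R)
    (L' : {RV P >-> R}) : Prop :=
  forall z : R, char_fun L' z = cexp (levy_exponent gamma b nu z).

(* The values of [a] on the negative half-line are irrelevant. *)
Record trawl_function (R : realType) (a : R -> R) : Prop := TrawlFunction {
  trawl_ge0 : forall x, 0 <= x -> 0 <= a x ;
  trawl_nonincreasing : forall x y, 0 <= x -> x <= y -> a y <= a x ;
  trawl_integrable :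
    (@lebesgue_measure R).-integrable `[0, +oo[ (fun x => (a x)%:E) ;
  trawl_continuous : {within `[0, +oo[, continuous a}
}.

Definition trawl_set (R : realType) (a : R -> R) (t : R) : set (R * R) :=
  [set (p.1 + t, p.2) | p in [set p : R * R | p.1 <= 0 /\ 0 <= p.2 <= a (- p.1)]].

(* [X] is a jointly measurable version of [t |-> L(A_t)]. *)
Definition trawl_process (R : realType) (d : measure_display)
    (T : measurableType d) (P : probability T R)
    (L : set (R * R) -> {RV P >-> R}) (a : R -> R) (X : R -> T -> R) : Prop :=
  measurable_fun [set: R * T] (fun p : R * T => X p.1 p.2) /\
  forall t : R, {ae P, forall w, X t w = L (trawl_set a t) w}.

Definition centered (R : realType) (d : measure_display)
    (T : measurableType d) (P : probability T R) (X : R -> T -> R)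
    (t : R) (w : T) : R :=
  X t w - fine ('E_P[X t])%E.

(* [Num.truncn] is the integer part on nonnegative reals, and 0 elsewhere. *)
Definition centered_sum (R : realType) (d : measure_display)
    (T : measurableType d) (P : probability T R) (X : R -> T -> R)
    (Delta : nat -> R) (n : nat) (t : R) (w : T) : R :=
  \sum_(0 <= k < Num.truncn (n%:R * t)) centered P X (k%:R * Delta n) w.

(* Extended-real-valued, so that a supremum over an uncountable index set need
   not be assumed finite; that each [Y n] is a random variable is part of the
   notion. *)
Definition cvg_in_probability (R : realType) (d : measure_display)
    (T : measurableType d) (P : probability T R) (Y : nat -> T -> \bar R)
    (l : R) : Prop :=
  (forall n, measurable_fun setT (Y n)) /\
  forall e : R, 0 < e ->
    P [set w | (e%:E < `|Y n w - l%:E|)%E] @[n --> \oo] --> 0%E.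

(* Main.v *)
(** Finiteness of [E |L'|^2] bounds [1 - |E e^{izL'}|] by a multiple of [z^2],
    hence [∫ (1 - cos zx) ν(dx) = O(z^2)], hence [∫ x^2 ν(dx)] is finite;
    therefore [Re ψ(z) = O(z^2)] and [Im ψ(z) = O(z)] near [0]. Inserting this
    in [E (1 - cos (z L(B))) = 1 - Re e^{Leb(B) ψ(z)}] and letting [z → 0] gives
    [E L(B)^2 <= K (Leb(B) + Leb(B)^2)]. Since [A_t \ A_s] and [A_s \ A_t] both
    have area at most [a(0) |t - s|], the trawl process is Lipschitz in the sense
    that [E (X_t - X_s)^2 <= C |t - s|] for [|t - s| <= 1].

    Pathwise, with [Z] the centered process, the error at time [t] is at most
    [∑_k ∫_{kΔ}^{(k+1)Δ} |Z_{kΔ} - Z_s| ds] plus the integral of [|Z|] between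
    [[nt]Δ] and [tμ]. The latter is at most [M δ + M^{-1} ∫_0^K Z^2] for every
    [M > 0], with [δ] a bound for [|[nt]Δ - tμ|], because [|x| <= M + x^2 / M].
    These bounds do not depend on [t]; their expectations are controlled by
    Tonelli's theorem, and Markov's inequality concludes on letting [n → ∞] and
    then [M → ∞]. *)

Require Import Defs.
From HB Require Import structures.
From mathcomp Require Import all_boot all_order all_algebra.
From mathcomp Require Import complex.
From mathcomp Require Import all_classical all_reals all_analysis.
From mathcomp Require Import measurable_realfun.
From mathcomp Require Import ring lra.

Import Order.TTheory GRing.Theory Num.Theory.
Import numFieldTopology.Exports numFieldNormedType.Exports.

Local Open Scope classical_set_scope.
Local Open Scope ring_scope.

Set Implicit Arguments.
Unset Strict Implicit.

(** * Trigonometric bounds and second moments *)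

Lemma norm_sin_le (R : realType) (u : R) : `|sin u| <= `|u|.
Proof.
wlog u0 : u / 0 <= u => [hw|].
  have [/hw//|/ltW u0] := leP 0 u.
  by rewrite -normrN -[leRHS]normrN -sinN; apply: hw; rewrite oppr_ge0.
have [c _] := @MVT_segment R sin cos 0 u u0 (fun x _ => is_derive_sin x)
  (continuous_subspaceT (@continuous_sin R)).
rewrite sin0 !subr0 => ->.
by rewrite normrM ler_piMl// cos_max.
Qed.

Lemma onem_cosE (R : realType) (u : R) : 1 - cos u = (sin (u / 2)) ^+ 2 *+ 2.
Proof. by rewrite -{1}(mulfVK (x:=2) _ u)// mulr_natr cos_mulr2n cos2sin2; ring. Qed.

Lemma onem_cos_le (R : realType) (u : R) : 1 - cos u <= u ^+ 2 / 2.
Proof.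
have h : sin (u / 2) ^+ 2 <= (u / 2) ^+ 2.
  rewrite -(real_normK (num_real (sin _))) -(real_normK (num_real (u / 2))).
  by rewrite ler_pXn2r ?nnegrE// norm_sin_le.
by rewrite onem_cosE; lra.
Qed.

(** By the half-angle formula [1 - cos u] is [2 sin(u/2)^2], and the mean value theorem gives
    [sin(u/2) = cos c * (u/2)] with [0 < c < u/2]. As [u/2 <= 1/2], [cos c >= 7/8], which leaves
    room for the factor [1/4]. *)
Lemma onem_cos_ge (R : realType) (u : R) : `|u| <= 1 -> u ^+ 2 / 4 <= 1 - cos u.
Proof.
wlog u0 : u / 0 <= u => [hw|].
  have [/hw//|/ltW u0] := leP 0 u.
  by rewrite -normrN -sqrrN -(cosN u); apply: hw; rewrite oppr_ge0.
rewrite ger0_norm// => u1.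
have v0 : 0 <= u / 2 by lra.
have [c] := @MVT_segment R sin cos 0 (u/2) v0 (fun x _ => is_derive_sin x)
  (continuous_subspaceT (@continuous_sin R)).
rewrite in_itv/= => /andP[c0 cu]; rewrite sin0 !subr0 => su.
rewrite onem_cosE su.
have hc : 7 / 8 <= cos c by have := onem_cos_le c; nra.
rewrite exprMn.
have : (7 / 8) ^+ 2 <= cos c ^+ 2 by rewrite ler_pXn2r// nnegrE; lra.
have : 0 <= (u / 2) ^+ 2 by exact: sqr_ge0.
nra.
Qed.

(** The mean value theorem turns the difference into [(1 - cos c) * u], and [1 - cos c = 2
    sin(c/2)^2 <= 2 |sin(c/2)| <= c]. The quadratic order is the one that a finite second moment of
    the Lévy measure can integrate. *)
Lemma norm_sinB_le (R : realType) (u : R) : `|sin u - u| <= u ^+ 2.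
Proof.
wlog u0 : u / 0 <= u => [hw|].
  have [/hw//|/ltW u0] := leP 0 u.
  by rewrite -normrN -sqrrN opprD -sinN; apply: hw; rewrite oppr_ge0.
have [c] := @MVT_segment R sin cos 0 u u0 (fun x _ => is_derive_sin x)
  (continuous_subspaceT (@continuous_sin R)).
rewrite in_itv/= => /andP[c0 cu]; rewrite sin0 !subr0 => ->.
have -> : cos c * u - u = - ((1 - cos c) * u) by ring.
rewrite normrN normrM (ger0_norm u0) expr2 ler_wpM2r//.
rewrite onem_cosE normrMn normrX expr2 mulr2n.
have h1 := norm_sin_le (c / 2); have h2 := sin_max (c / 2).
rewrite (@ger0_norm _ (c/2)) in h1; last lra.
have : 0 <= `|sin (c / 2)| by [].
nra.
Qed.

(** At [z = 1/n] the lower bound on [1 - cos] applies wherever [|f| <= n], so the second moment of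
    [f] truncated there is at most [4 n^2 * C / n^2 = 4 C]. Monotone convergence removes the
    truncation. The measure need not be finite: the lemma serves both the Lévy measure and the laws
    of the variables [L B]. *)
Lemma cos_second_moment (R : realType) (d : measure_display) (T : measurableType d)
  (m : {measure set T -> \bar R}) (D : set T) (f : T -> R) (C z0 : R) :
  measurable D -> measurable_fun D f -> 0 < z0 ->
  (forall z : R, 0 < z <= z0 ->
    (\int[m]_(x in D) (1 - cos (z * f x))%:E <= (C * z ^+ 2)%:E)%E) ->
  (\int[m]_(x in D) (f x ^+ 2)%:E <= (4 * C)%:E)%E.
Proof.
move=> mD mf z00 hC.
pose g (n : nat) (x : T) : \bar R :=
  ((f x ^+ 2) * \1_[set y : R | `|y| <= n%:R] (f x))%:E.
have mg n : measurable_fun D (g n).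
  apply/measurable_EFinP; apply: measurable_funM; first exact: measurable_funX.
  apply: measurableT_comp mf; apply: measurable_indic.
  rewrite (_ : [set _ | _] = `[- n%:R, n%:R]%classic); first exact: measurable_itv.
  by apply/seteqP; split => y /=; rewrite in_itv/= ler_norml.
have g0 n x : D x -> (0 <= g n x)%E.
  by move=> _; rewrite lee_fin mulr_ge0 ?sqr_ge0// indicE.
have ndg x : D x -> {homo g ^~ x : i j / (i <= j)%N >-> (i <= j)%E}.
  move=> _ i j ij; rewrite lee_fin ler_wpM2l ?sqr_ge0//.
  rewrite !indicE ler_nat; case: (boolP (_ \in _)) => //; rewrite inE/= => fi.
  by rewrite mem_set//= (le_trans fi)// ler_nat.
have mcos n : measurable_fun D (fun x => (1 - cos (n%:R^-1 * f x))%:E).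
  apply/measurable_EFinP; apply: measurable_funB => //.
  apply: measurableT_comp; first exact: (continuous_measurable_fun (@continuous_cos R)).
  exact: measurable_funM.
have lg x : limn (g ^~ x) = (f x ^+ 2)%:E.
  apply/cvg_lim => //; apply: cvg_near_cst.
  exists (Num.truncn `|f x|).+1 => // n /= hn; rewrite /g.
  rewrite indicE mem_set ?mulr1//=.
  apply/ltW/(lt_le_trans (truncnS_gt _)); by rewrite ler_nat.
rewrite (_ : \int[m]_(x in D) _ = \int[m]_(x in D) limn (g ^~ x))%E; last first.
  by apply: eq_integral => x _; rewrite lg.
rewrite monotone_convergence//.
apply: lime_le.
  by apply: ereal_nondecreasing_is_cvgn => i j ij; apply: ge0_le_integral => // x Dx;
    [exact: g0|exact: ndg].
(* From this index on [1/n <= z0], so the hypothesis applies at [z = 1/n]. *)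
exists (Num.truncn z0^-1).+1 => // n /= hn.
have n0 : (0 < n)%N by rewrite (leq_trans _ hn).
have nz : z0^-1 <= n%:R by apply/ltW/(lt_le_trans (truncnS_gt _)); rewrite ler_nat.
have hz : 0 < (n%:R : R)^-1 <= z0.
  by rewrite invr_gt0 ltr0n n0/= -[leRHS]invrK lef_pV2 ?posrE ?ltr0n ?invr_gt0.
have := hC _ hz => {}hC.
apply: (@le_trans _ _ (\int[m]_(x in D) ((4 * n%:R ^+ 2)%:E * (1 - cos (n%:R^-1 * f x))%:E))%E).
  apply: ge0_le_integral => //.
  - exact: g0.
  - exact: measurable_funeM.
  - move=> x Dx; rewrite -EFinM lee_fin.
    case: (leP `|f x| n%:R) => fn; last first.
      rewrite indicE memNset/=; last by apply/negP; rewrite -ltNge.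
      by rewrite mulr0 mulr_ge0// ?subr_ge0 ?cos_le1// mulr_ge0// sqr_ge0.
    have hf : `|n%:R^-1 * f x| <= 1.
      by rewrite normrM ger0_norm// ler_pdivrMl ?ltr0n// mulr1.
    rewrite indicE mem_set// mulr1.
    have n2 : 0 < 4 * n%:R ^+ 2 :> R by rewrite mulr_gt0// exprn_gt0// ltr0n.
    rewrite (_ : f x ^+ 2 = 4 * n%:R ^+ 2 * ((n%:R^-1 * f x) ^+ 2 / 4)).
      by rewrite ler_pM2l//; exact: onem_cos_ge.
    by rewrite exprMn exprVn; field; rewrite pnatr_eq0 -lt0n.
rewrite ge0_integralZl//.
apply: (@le_trans _ _ ((4 * n%:R ^+ 2)%:E * (C * n%:R^-1 ^+ 2)%:E)%E).
    by rewrite lee_wpmul2l// lee_fin mulr_ge0// sqr_ge0.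
  rewrite -EFinM lee_fin le_eqVlt; apply/orP; left; apply/eqP.
  rewrite exprVn; field.
  by rewrite pnatr_eq0 -lt0n.
Qed.

(** * The Lévy exponent near zero *)

Section complex_exponential.
Variable R : realType.

Lemma Re_cexp_i (x : R) : complex.Re (cexp ('i%C * x%:C)%C) = cos x.
Proof. by rewrite /cexp /= !(mul0r, mul1r, mulr0, subr0, addr0, add0r, oppr0) expR0 mul1r. Qed.

Lemma Re_cexpZ (c : R) (u : R[i]) : complex.Re (cexp (c%:C%C * u)) =
  expR (c * complex.Re u) * cos (c * complex.Im u).
Proof. by case: u => x y; rewrite /cexp /= !(mul0r, subr0, addr0). Qed.

Lemma Re_levy_exponent (gamma b : R) (nu : {measure set R -> \bar R}) (z : R) :
  complex.Re (levy_exponent gamma b nu z) =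
  - (2^-1 * b ^+ 2 * z ^+ 2) + \int[nu]_(x in ~` [set 0]) (cos (z * x) - 1).
Proof.
rewrite /levy_exponent /cintegral /=.
rewrite !(mul0r, mul1r, mulr0, subr0, addr0, add0r, sub0r, oppr0); congr (_ + _).
apply: eq_Rintegral => x _.
by rewrite !(mul0r, mul1r, mulr0, subr0, addr0, add0r, sub0r, oppr0) expR0 !mul1r.
Qed.

Lemma Im_levy_exponent (gamma b : R) (nu : {measure set R -> \bar R}) (z : R) :
  complex.Im (levy_exponent gamma b nu z) =
  gamma * z + \int[nu]_(x in ~` [set 0])
    (sin (z * x) - z * x * \1_[set y : R | `|y| <= 1] x).
Proof.
rewrite /levy_exponent /cintegral /=.
rewrite !(mul0r, mul1r, mulr0, subr0, addr0, add0r, sub0r, oppr0); congr (_ + _).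
apply: eq_Rintegral => x _.
by rewrite !(mul0r, mul1r, mulr0, subr0, addr0, add0r, sub0r, oppr0) expR0 !mul1r.
Qed.

End complex_exponential.

Section levy_exponent_near_zero.
Variables (R : realType) (gamma b : R) (nu : {measure set R -> \bar R}).
Hypothesis lnu : levy_measure nu.

Let D : set R := ~` [set 0].
Let mD : measurable D. Proof. exact: measurableC. Qed.

Let measurable_cosz (z : R) : measurable_fun D (fun x : R => cos (z * x)).
Proof.
apply: measurableT_comp; first exact: (continuous_measurable_fun (@continuous_cos R)).
exact: measurable_funM.
Qed.

(** For [z <= 1] the integrand is at most [2 min(1, x^2)], which a Lévy measure integrates. *)
Lemma integrable_onem_cos_levy (z : R) : 0 < z <= 1 ->
  nu.-integrable (~` [set 0]) (fun x => (1 - cos (z * x))%:E).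
Proof.
move=> /andP[z0 z1]; apply/integrableP; split.
  by apply/measurable_EFinP; apply: measurable_funB => //; exact: measurable_cosz.
have mm : measurable_fun D (fun x : R => (Num.min 1 (x ^+ 2))%:E).
  by apply/measurable_EFinP; apply: measurable_minr => //; exact: measurable_funX.
apply: (@le_lt_trans _ _ (\int[nu]_(x in D) (2%:E * (Num.min 1 (x ^+ 2))%:E))%E).
  apply: ge0_le_integral => //.
  - apply: measurableT_comp => //; apply/measurable_EFinP.
    by apply: measurable_funB => //; exact: measurable_cosz.
  - exact: measurable_funeM.
  - move=> x _; rewrite -EFinM/= lee_fin ger0_norm ?subr_ge0 ?cos_le1//.
    rewrite minEle; case: ifPn => _.
      by have := cos_geN1 (z * x); lra.
    apply: (le_trans (onem_cos_le _)); rewrite exprMn.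
    have : 0 <= x ^+ 2 by exact: sqr_ge0.
    have : z ^+ 2 <= 1 by rewrite expr_le1// ltW.
    nra.
rewrite ge0_integralZl//; last first.
  by move=> x _; rewrite lee_fin le_min ler01 sqr_ge0.
rewrite lte_mul_pinfty//.
apply: le_lt_trans lnu.2.
apply: ge0_subset_integral => //.
  by apply/measurable_EFinP; apply: measurable_minr => //; exact: measurable_funX.
by move=> x _; rewrite lee_fin le_min ler01 sqr_ge0.
Qed.

(** Integrability ensures that the real-valued integral inside [levy_exponent] is the genuine one
    and not the default value of [fine] at infinity. *)
Lemma Re_levy_exponentE (z : R) : 0 < z <= 1 ->
  (\int[nu]_(x in ~` [set 0%R]) (1 - cos (z * x))%:E =
   (- (2^-1 * b ^+ 2 * z ^+ 2) - complex.Re (levy_exponent gamma b nu z))%:E)%E.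
Proof.
move=> hz; have ic := integrable_onem_cos_levy hz.
rewrite -[LHS]fineK; last exact: integrable_fin_num.
congr EFin; rewrite Re_levy_exponent opprD addrA subrr add0r.
rewrite -[LHS]/(\int[nu]_(x in D) (1 - cos (z * x))).
rewrite -[RHS]mulN1r -RintegralZl//.
  by apply: eq_Rintegral => x _; rewrite mulN1r opprB.
rewrite (_ : _ \o _ = (fun x : R => - (1 - cos (z * x))%:E)%E).
  exact: integrableN.
by apply/funext => x/=; rewrite opprB.
Qed.

Lemma Re_levy_exponent_le0 (z : R) : 0 < z <= 1 ->
  complex.Re (levy_exponent gamma b nu z) <= 0.
Proof.
move=> hz; have : (0 <= \int[nu]_(x in ~` [set 0%R]) (1 - cos (z * x))%:E)%E.
  by apply: integral_ge0 => x _; rewrite lee_fin subr_ge0 cos_le1.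
rewrite Re_levy_exponentE// lee_fin.
have : 0 <= 2^-1 * b ^+ 2 * z ^+ 2.
  by rewrite -mulrA mulr_ge0 ?invr_ge0 ?ler0n// mulr_ge0 ?sqr_ge0.
lra.
Qed.

(** The hypothesis forces [Re psi >= - 2 M z^2] near zero. Hence the integral of [1 - cos (z x)]
    against [nu] is at most [2 M z^2], [nu] has a finite second moment, and this moment controls the
    imaginary part. *)
Lemma levy_exponent_bound (M z0 : R) : 0 <= M -> 0 < z0 ->
  (forall z : R, 0 < z <= z0 ->
    1 - M * z ^+ 2 <= expR (complex.Re (levy_exponent gamma b nu z))) ->
  exists K z1 : R, [/\ 0 <= K, 0 < z1 & forall z : R, 0 < z <= z1 ->
    [/\ complex.Re (levy_exponent gamma b nu z) <= 0,
        - (K * z ^+ 2) <= complex.Re (levy_exponent gamma b nu z) &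
        `|complex.Im (levy_exponent gamma b nu z)| <= K * z ] ].
Proof.
move=> M0 z00 hM.
(* The last term makes [u = M z^2] at most [1/2], the range in which [1 / (1 + 2 u) <= 1 - u] and
   hence [expR (- 2 u) <= 1 - u]. *)
pose z1 := Num.min z0 (Num.min 1 (2 * M + 1)^-1).
have z10 : 0 < z1.
  by rewrite !lt_min z00 ltr01/= invr_gt0; lra.
have small (z : R) : 0 < z <= z1 -> [/\ 0 < z <= z0, 0 < z <= 1 & M * z ^+ 2 <= 2^-1 ].
  rewrite !le_min => /and4P[z_gt0 zz0 zle1 zM]; rewrite z_gt0 zz0 zle1; split=> //.
  have {}zM : z * (2 * M + 1) <= 1.
    by rewrite -ler_pdivlMr ?div1r//; lra.
  nra.
have Rele (z : R) : 0 < z <= z1 ->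
    - (2 * M * z ^+ 2) <= complex.Re (levy_exponent gamma b nu z).
  move=> /small[zz0 zle1 zM]; have h := hM _ zz0.
  rewrite -ler_expR; apply: le_trans h.
  rewrite expRN invf_ple ?posrE ?expR_gt0//; last lra.
  apply: le_trans (expR_ge1Dx _).
  rewrite -div1r ler_pdivrMr; last lra.
  have : 0 <= M * z ^+ 2 by rewrite mulr_ge0// sqr_ge0.
  set u := M * z ^+ 2 => u0; rewrite -/u in zM; rewrite -mulrA -/u; nra.
have mom : (\int[nu]_(x in D) (x ^+ 2)%:E <= (4 * (2 * M))%:E)%E.
  apply: (@cos_second_moment _ _ _ _ _ id _ z1) => // z hz.
  have [_ zle1 _] := small _ hz.
  rewrite Re_levy_exponentE// lee_fin.
  have := Rele _ hz.
  have : 0 <= 2^-1 * b ^+ 2 * z ^+ 2.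
  by rewrite -mulrA mulr_ge0 ?invr_ge0 ?ler0n// mulr_ge0 ?sqr_ge0.
  lra.
have ix2 : nu.-integrable D (fun x : R => (x ^+ 2)%:E).
  apply/integrableP; split; first by apply/measurable_EFinP; exact: measurable_funX.
  rewrite (eq_integral (fun x : R => (x ^+ 2)%:E)).
    by rewrite (le_lt_trans mom)// ltry.
  by move=> x _; rewrite /= ger0_norm// sqr_ge0.
pose N := \int[nu]_(x in D) (x ^+ 2 : R).
have N0 : 0 <= N by apply: Rintegral_ge0 => x _; exact: sqr_ge0.
exists (2 * M + (`|gamma| + N)), z1; split => //.
  by rewrite !addr_ge0// mulr_ge0.
move=> z hz; have [_ zle1 _] := small _ hz; split.
- exact: Re_levy_exponent_le0.
- apply: le_trans (Rele _ hz); rewrite lerN2 ler_wpM2r ?sqr_ge0//.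
  by rewrite lerDl addr_ge0.
have z0' : 0 <= z by case/andP: zle1 => /ltW.
pose g (x : R) := sin (z * x) - z * x * \1_[set y : R | `|y| <= 1] x.
(* For [|x| <= 1] the compensated sine is at most [(z x)^2 <= z x^2]; for larger [x] there is no
   compensation and [|sin (z x)| <= z |x| <= z x^2]. *)
have gle (x : R) : `|g x| <= z * x ^+ 2.
  rewrite /g indicE; have [x1|x1] := leP `|x| 1.
    rewrite mem_set// mulr1; apply: (le_trans (norm_sinB_le _)).
    rewrite exprMn ler_wpM2r ?sqr_ge0// expr2 ler_piMl//; by case/andP: zle1.
  rewrite memNset/=; last by apply/negP; rewrite -ltNge.
  rewrite mulr0 subr0 (le_trans (norm_sin_le _))// normrM (ger0_norm z0').
  rewrite ler_wpM2l// -real_normK ?num_real// expr2 ler_peMl// ltW//.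
have mg : measurable_fun D g.
  apply: measurable_funB.
    apply: measurableT_comp; first exact: (continuous_measurable_fun (@continuous_sin R)).
    exact: measurable_funM.
  apply: measurable_funM; first exact: measurable_funM.
  apply: measurable_funTS; apply: measurable_indic.
  rewrite (_ : [set _ | _] = `[- 1, 1]%classic); first exact: measurable_itv.
  by apply/seteqP; split => y /=; rewrite in_itv/= ler_norml.
have izx2 : nu.-integrable D (EFin \o (fun x : R => z * x ^+ 2)).
  rewrite (_ : _ \o _ = (fun x : R => z%:E * (x ^+ 2)%:E)%E).
    exact: integrableZl.
  by apply/funext => x/=; rewrite EFinM.
have ig : nu.-integrable D (EFin \o g).
  apply: le_integrable izx2 => //; first exact/measurable_EFinP.
  move=> x _ /=; rewrite lee_fin (le_trans (gle x))// ler_norm//.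
rewrite Im_levy_exponent -/g.
have -> : (2 * M + (`|gamma| + N)) * z = 2 * M * z + (`|gamma| * z + z * N) by ring.
apply: (le_trans (ler_normD _ _)); rewrite ler_wpDl ?mulr_ge0//.
rewrite lerD//.
  by rewrite normrM (ger0_norm z0').
apply: (le_trans (le_normr_Rintegral _ ig)) => //.
rewrite /N -RintegralZl//; apply: le_Rintegral => //.
exact: (integrable_norm ig).
Qed.

End levy_exponent_near_zero.

Lemma onem_Re_char_fun (R : realType) (d : measure_display) (T : measurableType d)
    (P : probability T R) (Y : {RV P >-> R}) (z : R) :
  (\int[P]_w (1 - cos (z * Y w))%:E = (1 - complex.Re (char_fun Y z))%:E)%E.
Proof.
have mc : measurable_fun setT (fun w => cos (z * Y w)).
  apply: measurableT_comp; first exact: (continuous_measurable_fun (@continuous_cos R)).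
  exact: measurable_funM.
have ic : P.-integrable setT (EFin \o (fun w => cos (z * Y w))).
  apply: (@le_integrable _ _ _ P _ measurableT _ (EFin \o cst 1)).
  - exact/measurable_EFinP.
  - by move=> w _ /=; rewrite lee_fin normr1 cos_max.
  - exact: finite_measure_integrable_cst.
have i1 : P.-integrable setT (EFin \o (cst 1 : T -> R)).
  exact: finite_measure_integrable_cst.
rewrite -[LHS]fineK; last first.
  apply: integrable_fin_num => //.
  have := integrableB measurableT i1 ic; congr (_.-integrable _ _).
rewrite -[fine _]/(\int[P]_w (1 - cos (z * Y w))) RintegralB// Rintegral_cst//.
rewrite [X in fine X]probability_setT mulr1 /char_fun/=; congr (1 - _)%:E.
by apply: eq_Rintegral => w _; rewrite -Re_cexp_i.
Qed.

(** The modulus [expR (Re psi)] of the characteristic function dominates its real part, which is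
    [1 - E (1 - cos (z Y)) >= 1 - z^2 E Y^2]. So [M] is the second moment of [Y]. *)
Lemma seed_exponent_bound (R : realType) (d : measure_display) (T : measurableType d)
    (P : probability T R) (Y : {RV P >-> R}) (psi : R -> R[i]) :
  (forall z, char_fun Y z = cexp (psi z)) ->
  ('E_P[fun w => (`|Y w| ^+ 2)%R] < +oo)%E ->
  exists2 M : R, 0 <= M &
    forall z, 1 - M * z ^+ 2 <= expR (complex.Re (psi z)).
Proof.
move=> hchar; rewrite unlock => Y2oo.
have Y2_ge0 : (0 <= \int[P]_w (`|Y w| ^+ 2)%:E)%E.
  by apply: integral_ge0 => w _; rewrite lee_fin sqr_ge0.
have mY2 : measurable_fun setT (fun w => (`|Y w| ^+ 2)%:E).
  by apply/measurable_EFinP; apply: measurable_funX; exact: measurableT_comp.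
exists (fine (\int[P]_w (`|Y w| ^+ 2)%:E)%E); first exact: fine_ge0.
move=> z.
have : (\int[P]_w (1 - cos (z * Y w))%:E <=
        \int[P]_w ((z ^+ 2)%:E * (`|Y w| ^+ 2)%:E))%E.
  apply: ge0_le_integral => //.
  - apply/measurable_EFinP; apply: measurable_funB => //.
    apply: measurableT_comp; first exact: (continuous_measurable_fun (@continuous_cos R)).
    exact: measurable_funM.
  - exact: measurable_funeM.
  - move=> w _; rewrite -EFinM lee_fin (le_trans (onem_cos_le _))//.
    rewrite real_normK ?num_real// exprMn.
    have : 0 <= z ^+ 2 * Y w ^+ 2 by rewrite mulr_ge0 ?sqr_ge0.
    lra.
rewrite onem_Re_char_fun ge0_integralZl//; last first.
  by rewrite lee_fin sqr_ge0.
rewrite -[X in (_ * X)%E]fineK; last by rewrite ge0_fin_numE.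
rewrite -EFinM lee_fin hchar /cexp/= => h.
have := cos_le1 (complex.Im (psi z)).
have := expR_gt0 (complex.Re (psi z)).
nra.
Qed.

(** With [r] and [i] the real and imaginary parts of [psi z], [1 - expR (c r) cos (c i) <= - c r +
    (c i)^2], and both terms are of order [z^2]. The term linear in [c] accounts for the variance,
    the quadratic one for the squared mean. *)
Lemma second_moment_infdiv (R : realType) (d : measure_display) (T : measurableType d)
    (P : probability T R) (Y : {RV P >-> R}) (psi : R -> R[i]) (c K z1 : R) :
  0 <= c -> 0 <= K -> 0 < z1 ->
  (forall z, char_fun Y z = cexp (c%:C%C * psi z)) ->
  (forall z : R, 0 < z <= z1 -> [/\ complex.Re (psi z) <= 0,
     - (K * z ^+ 2) <= complex.Re (psi z) & `|complex.Im (psi z)| <= K * z ]) ->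
  (\int[P]_w (Y w ^+ 2)%:E <= (4 * (c * K + c ^+ 2 * K ^+ 2))%:E)%E.
Proof.
move=> c0 K0 z10 hY hpsi.
apply: (cos_second_moment _ _ z10) => // z hz.
have [R0 RK IK] := hpsi _ hz.
rewrite onem_Re_char_fun hY Re_cexpZ lee_fin.
set r := complex.Re _ in R0 RK *; set i := complex.Im _ in IK *.
have z0 : 0 <= z by case/andP: hz => /ltW.
have e1 : expR (c * r) <= 1 by rewrite -expR0 ler_expR mulr_ge0_le0.
have e0 := expR_gt0 (c * r).
have e2 := expR_ge1Dx (c * r).
have h1 : c * - (K * z ^+ 2) <= c * r by rewrite ler_wpM2l.
have h2 := onem_cos_le (c * i).
have h3 : (c * i) ^+ 2 <= c ^+ 2 * (K * z) ^+ 2.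
  rewrite exprMn ler_wpM2l ?sqr_ge0// -real_normK ?num_real//.
  by rewrite ler_pXn2r ?nnegrE// mulr_ge0.
have h4 := cos_le1 (c * i).
have h5 : 0 <= (c * i) ^+ 2 by exact: sqr_ge0.
have : 1 - expR (c * r) * cos (c * i) <= - (c * r) + (c * i) ^+ 2 by nra.
move/le_trans; apply.
rewrite mulrDl; apply: lerD; first lra.
by rewrite -mulrA -exprMn.
Qed.

(** * Trawl sets *)

Section trawl_sets.
Variables (R : realType) (a : R -> R).
Hypothesis ta : trawl_function a.

Lemma trawl_setE (t : R) :
  trawl_set a t = [set p : R * R | p.1 <= t /\ 0 <= p.2 <= a (t - p.1)].
Proof.
apply/seteqP; split => [p [[x y] /= [x0 ya] <-]|[x y] /= [xt ya]]/=.
  split; first by rewrite gerDr.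
  by rewrite opprD addrCA subrr addr0.
exists (x - t, y); first by split=> /=; rewrite ?subr_le0// opprB.
by rewrite /= subrK.
Qed.

Lemma measurable_reflect (t : R) : measurable_fun setT (fun x : R => t - x).
Proof. by apply: measurable_funB. Qed.

(** The image of Lebesgue measure under the reflection agrees with it on half-open intervals, whose
    preimages are half-open on the other side but of equal length; uniqueness of Lebesgue measure
    concludes. *)
Lemma lebesgue_measure_reflect (t : R) (A : set R) : measurable A ->
  lebesgue_measure ((fun x : R => t - x) @^-1` A) = lebesgue_measure A.
Proof.
move=> mA; apply/esym.
have mphi : measurable_fun [set: measurableTypeR R]
  (fun x : measurableTypeR R => (t - x : R) : measurableTypeR R).
  exact: (measurable_reflect t).
pose phi : {mfun measurableTypeR R >-> measurableTypeR R} :=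
  HB.pack (fun x : measurableTypeR R => (t - x : R) : measurableTypeR R)
  (isMeasurableFun.Build _ _ _ _ _ mphi).
have := @lebesgue_measure_unique R
  [the {measure set _ -> \bar R} of pushforward (@lebesgue_measure R) phi].
apply => // X [[x y] _ <-] /=.
rewrite /pushforward (_ : _ @^-1` _ = `[t - y, t - x[%classic); last first.
  by apply/seteqP; split => z /=; rewrite !in_itv/= => /andP[? ?]; apply/andP; split; lra.
rewrite !lebesgue_measure_itv/= !lte_fin ltrD2l ltrN2 !EFinB; case: ifPn => // _.
by rewrite -!EFinB; congr EFin; ring.
Qed.

Lemma integral_reflect (t : R) (f : R -> \bar R) :
  measurable_fun setT f -> (forall x, 0 <= f x)%E ->
  (\int[lebesgue_measure]_x f (t - x)%R = \int[lebesgue_measure]_x f x)%E.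
Proof.
move=> mf f0.
have mphi : measurable_fun [set: measurableTypeR R]
  (fun x : measurableTypeR R => (t - x : R) : measurableTypeR R).
  exact: (measurable_reflect t).
have := @ge0_integral_pushforward _ _ _ _ R _ mphi (@lebesgue_measure R) setT f
  measurableT mf (fun x _ => f0 x).
rewrite preimage_setT => <-.
apply: eq_measure_integral => A mA _.
exact: lebesgue_measure_reflect.
Qed.

(** Extending the trawl function by zero gives one formula for the length of every vertical section,
    including the empty ones at abscissas beyond [t]. *)
Let h : R -> R := a \_ `[0, +oo[.

Let hE (u : R) : 0 <= u -> h u = a u.
Proof. by move=> u0; rewrite /h patchE mem_set//= in_itv/= u0. Qed.

Let h0 u : 0 <= h u.
Proof.
rewrite /h patchE; case: ifPn => //; rewrite inE/= in_itv/= andbT.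
exact: trawl_ge0.
Qed.

Let mh : measurable_fun setT h.
Proof.
have ma : measurable_fun (`[0, +oo[%classic : set R) a.
  by have /integrableP[/measurable_EFinP] := trawl_integrable ta.
exact: (measurable_restrictT a (measurable_itv `[0 : R, +oo[)).1.
Qed.

Lemma measurable_trawl_set (t : R) : measurable (trawl_set a t).
Proof.
have -> : trawl_set a t = (fun p : R * R => p.1 <= t) @^-1` [set true] `&`
   ((fun p : R * R => 0 <= p.2) @^-1` [set true] `&`
    (fun p : R * R => p.2 <= h (t - p.1)) @^-1` [set true]).
  rewrite trawl_setE; apply/seteqP; split => [[x y] /= [xt /andP[y0 ya]]|[x y]/= [xt [y0 ya]]].
    by rewrite hE ?subr_ge0.
  by rewrite hE ?subr_ge0// in ya; rewrite y0 ya.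
have m1 : measurable_fun setT (fun p : R * R => h (t - p.1)).
  by apply: measurableT_comp mh _; apply: measurable_funB.
apply: measurableI; [|apply: measurableI];
  rewrite -[X in measurable X]setTI;
  by apply: measurable_fun_ler => //; exact: measurable_snd.
Qed.

Lemma xsection_trawl_set (t x : R) :
  lebesgue_measure (xsection (trawl_set a t) x) = (h (t - x))%:E.
Proof.
have -> : xsection (trawl_set a t) x = if x <= t then `[0, a (t - x)]%classic else set0.
  apply/seteqP; split => y; rewrite /xsection/= inE trawl_setE/=.
    by move=> [-> ?]/=; rewrite in_itv.
  by case: ifPn => // xt; rewrite /= in_itv.
case: ifPn => xt.
  rewrite lebesgue_measure_itv/= lte_fin hE ?subr_ge0//.
  have := trawl_ge0 ta (x := t - x); rewrite subr_ge0 => /(_ xt).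
  by rewrite le_eqVlt => /predU1P[<-|->]; rewrite ?ltxx// sube0.
rewrite measure0 /h patchE memNset//=.
by rewrite in_itv/= andbT subr_ge0; exact/negP.
Qed.

(** The area is the integral of the section lengths [h (t - x)], which a reflection turns into the
    integral of [h]; the value is the same for all [t]. *)
Lemma lebesgue2_trawl_set (t : R) :
  lebesgue2 (trawl_set a t) = (\int[lebesgue_measure]_(x in `[0%R, +oo[) (a x)%:E)%E.
Proof.
rewrite /lebesgue2 /product_measure1.
under eq_integral do rewrite /= xsection_trawl_set.
rewrite (@integral_reflect t (fun x => (h x)%:E)); last 2 first.
- exact/measurable_EFinP.
- by move=> x; rewrite lee_fin.
by rewrite [RHS]integral_mkcond restrict_EFin.
Qed.

Lemma borel_finite_trawl_set (t : R) : borel_finite (trawl_set a t).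
Proof.
split; first exact: measurable_trawl_set.
rewrite lebesgue2_trawl_set.
have /integrableP[_] := trawl_integrable ta.
congr (_ < _)%E; apply: eq_integral => x; rewrite inE/= in_itv/= andbT => x0.
by rewrite ger0_norm// trawl_ge0.
Qed.

Let leb2 := [the {measure set (measurableTypeR R * measurableTypeR R) -> \bar R} of
  (@lebesgue_measure R \x @lebesgue_measure R)%E].

(** A point of [A_t] with abscissa [x <= s] has height at most [a (t - x) <= a (s - x)] and so lies
    in [A_s]. The difference is therefore contained in the rectangle with base []s, t]] and height
    [a 0]. *)
Lemma lebesgue2_trawl_setD (s t : R) : s <= t ->
  (lebesgue2 (trawl_set a t `\` trawl_set a s) <= (a 0 * (t - s))%:E)%E.
Proof.
move=> st.
have : trawl_set a t `\` trawl_set a s `<=` `]s, t]%classic `*` `[0, a 0]%classic.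
  rewrite !trawl_setE => -[x y] /= [[xt /andP[y0 ya]] nA].
  have xs : s < x.
    rewrite ltNge; apply/negP => xs; apply: nA; split => //; rewrite y0/=.
    by apply: (le_trans ya); apply: trawl_nonincreasing => //; lra.
  rewrite !in_itv/= xs xt y0; split => //=; apply: (le_trans ya).
  by apply: trawl_nonincreasing => //; lra.
move=> sub.
have m1 : measurable (`]s, t]%classic `*` `[0, a 0]%classic : set (R * R)).
  by apply: measurableX; exact: measurable_itv.
have m2 : measurable (trawl_set a t `\` trawl_set a s).
  by apply: measurableD; exact: measurable_trawl_set.
apply: (le_trans (le_measure leb2 _ _ sub)); rewrite ?inE//.
rewrite [leLHS](_ : _ = lebesgue_measure (`]s, t]%classic : set R) *
    lebesgue_measure (`[0%R, a 0]%classic : set R))%E; last first.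
  by apply: product_measure1E; exact: measurable_itv.
rewrite !lebesgue_measure_itv/= !lte_fin.
have := trawl_ge0 ta (lexx 0); rewrite le_eqVlt => /predU1P[<-|a0].
  by rewrite ltxx mule0 mul0r.
rewrite a0 oppr0 adde0; case: ifPn => ts.
  by rewrite -EFinB -EFinM mulrC.
by rewrite mul0e lee_fin mulr_ge0 ?subr_ge0// ltW.
Qed.

(* Both trawl sets have the same finite area, so the two differences do too. *)
Lemma lebesgue2_trawl_setDC (s t : R) :
  lebesgue2 (trawl_set a t `\` trawl_set a s) =
  lebesgue2 (trawl_set a s `\` trawl_set a t).
Proof.
have ms := measurable_trawl_set s; have mt := measurable_trawl_set t.
have fin u : leb2 (trawl_set a u) \is a fin_num.
  by rewrite ge0_fin_numE//; exact: (borel_finite_trawl_set u).2.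
have st : leb2 (trawl_set a s) = leb2 (trawl_set a t).
  by have := lebesgue2_trawl_set s; rewrite -(lebesgue2_trawl_set t).
have D u v : leb2 (trawl_set a u `\` trawl_set a v) =
    (leb2 (trawl_set a u) - leb2 (trawl_set a u `&` trawl_set a v))%E.
  by apply: measureD; [exact: measurable_trawl_set|exact: measurable_trawl_set|rewrite ltey_eq fin].
by have := D t s; rewrite -st setIC -D.
Qed.

End trawl_sets.

(** * Second moments of the trawl process *)

Section levy_basis_moments.
Variables (R : realType) (d : measure_display) (T : measurableType d).
Variables (P : probability T R) (gamma b : R) (nu : {measure set R -> \bar R}).
Variable L : set (R * R) -> {RV P >-> R}.
Hypothesis lL : levy_basis gamma b nu L.

Lemma lebesgue2_ge0 (B : set (R * R)) : (0 <= lebesgue2 B)%E.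
Proof. by apply: integral_ge0. Qed.

Lemma le_lebesgue2 (A B : set (R * R)) :
  measurable A -> measurable B -> A `<=` B -> (lebesgue2 A <= lebesgue2 B)%E.
Proof.
move=> mA mB AB.
have := @le_measure _ _ _ [the {measure set (measurableTypeR R * measurableTypeR R) -> \bar R} of
  (@lebesgue_measure R \x @lebesgue_measure R)%E] A B.
by apply => //; rewrite inE.
Qed.

Lemma borel_finite_subset (A B : set (R * R)) :
  measurable A -> A `<=` B -> borel_finite B -> borel_finite A.
Proof.
move=> mA AB [mB Boo]; split => //; exact: le_lt_trans (le_lebesgue2 mA mB AB) Boo.
Qed.

(** The seed acts only through its characteristic function, so it may live on another probability
    space. The constant comes from the exponent alone and is therefore uniform over all sets [B]. *)
Lemma levy_basis_second_moment (d' : measure_display) (T' : measurableType d')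
    (P' : probability T' R) (L' : {RV P' >-> R}) :
  is_seed gamma b nu L' ->
  ('E_P'[fun w => (`|L' w| ^+ 2)%R] < +oo)%E ->
  exists2 K : R, 0 <= K & forall B (c : R), borel_finite B ->
    (lebesgue2 B <= c%:E)%E ->
    (\int[P]_w (L B w ^+ 2)%:E <= (K * (c + c ^+ 2))%:E)%E.
Proof.
move=> sL' L'oo.
have [M M0 hM] := seed_exponent_bound sL' L'oo.
have [K [z1 [K0 z10 hK]]] := levy_exponent_bound (levy_basis_levy_measure lL) M0
  ltr01 (fun z _ => hM z).
exists (4 * (K + K ^+ 2)).
  by have := sqr_ge0 K; lra.
move=> B c hB Bc.
have f0 : 0 <= fine (lebesgue2 B) by exact/fine_ge0/lebesgue2_ge0.
have fc : fine (lebesgue2 B) <= c.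
  rewrite -lee_fin fineK// ge0_fin_numE; first exact: hB.2.
  exact: lebesgue2_ge0.
have := second_moment_infdiv f0 K0 z10
  (fun z => levy_basis_char_fun lL z hB) hK.
move=> /le_trans; apply; rewrite lee_fin.
set f := fine _ in f0 fc *.
have : f ^+ 2 <= c ^+ 2 by rewrite ler_pXn2r// nnegrE (le_trans f0).
have := sqr_ge0 K; have := sqr_ge0 f; nra.
Qed.

(** Countable additivity is applied to the sequence [A, B, set0, set0, ...]. Convergence of the
    series forces its terms to vanish in the limit; since they are eventually equal to [L set0 w],
    this value is 0 on the event considered. *)
Lemma levy_basisU (A B : set (R * R)) :
  borel_finite A -> borel_finite B -> borel_finite (A `|` B) -> A `&` B = set0 ->
  {ae P, forall w, L (A `|` B) w = L A w + L B w}.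
Proof.
move=> hA hB hAB AB0.
have -> : A `|` B = \bigcup_k bigcup2 A B k by rewrite bigcup2E.
have hF : borel_finite (\bigcup_k bigcup2 A B k) by rewrite bigcup2E.
have mF k : measurable (bigcup2 A B k).
  by case: k => [|[|k]] /=; [exact: hA.1|exact: hB.1|exact: measurable0].
have tF : trivIset setT (bigcup2 A B) by rewrite -trivIset_bigcup2.
apply: filterS (levy_basis_additive lL mF tF hF) => w cw.
set S := L (\bigcup_k bigcup2 A B k) w in cw *.
pose u (k : nat) := L (bigcup2 A B k) w.
have cu : series u @ \oo --> S.
  by apply: cvg_trans cw; rewrite /series/=.
have u0 : u @ \oo --> 0 by apply: cvg_series_cvg_0; apply/cvg_ex; exists S.
have L0 : L set0 w = 0.
  have : u @ \oo --> L set0 w.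
    apply: cvg_near_cst; exists 2%N => // n /= n2.
    by case: n n2 => [|[|n]].
  by move/cvg_lim => <- //; apply/cvg_lim.
have : series u @ \oo --> L A w + L B w.
  apply: cvg_near_cst; exists 2%N => // n /= n2.
  rewrite -(subnKC n2) /series/= big_nat_recl// big_nat_recl//= big1 ?addr0//.
move/cvg_lim => <- //; apply/esym/cvg_lim => //.
Qed.

End levy_basis_moments.

Section trawl_process_moments.
Variables (R : realType) (d : measure_display) (T : measurableType d).
Variables (P : probability T R) (gamma b : R) (nu : {measure set R -> \bar R}).
Variables (L : set (R * R) -> {RV P >-> R}) (a : R -> R) (X : R -> T -> R).
Variables (d' : measure_display) (T' : measurableType d').
Variables (P' : probability T' R) (L' : {RV P' >-> R}).
Hypothesis lL : levy_basis gamma b nu L.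
Hypothesis sL' : is_seed gamma b nu L'.
Hypothesis L'oo : ('E_P'[fun w => (`|L' w| ^+ 2)%R] < +oo)%E.
Hypothesis ta : trawl_function a.
Hypothesis tX : trawl_process L a X.

Lemma measurable_trawl_process (t : R) : measurable_fun setT (X t).
Proof.
have := measurableT_comp tX.1 (@pair1_measurable _ _ _ _ t).
exact.
Qed.

Lemma trawl_process_second_moment :
  exists2 C : R, 0 <= C & forall t, (\int[P]_w (X t w ^+ 2)%:E <= C%:E)%E.
Proof.
have [K K0 hK] := levy_basis_second_moment lL sL' L'oo.
pose c := fine (\int[lebesgue_measure]_(x in `[0%R, +oo[) (a x)%:E)%E.
have c0 : 0 <= c.
  apply: fine_ge0; apply: integral_ge0 => x.
  by rewrite /= in_itv/= andbT lee_fin => /(trawl_ge0 ta).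
exists (K * (c + c ^+ 2)).
  by rewrite mulr_ge0// addr_ge0// sqr_ge0.
move=> t; apply: le_trans (hK _ c (borel_finite_trawl_set ta t) _); last first.
  have := (borel_finite_trawl_set ta t).2; rewrite (lebesgue2_trawl_set ta) => fin.
  rewrite fineK// ge0_fin_numE//; apply: integral_ge0 => x.
  by rewrite /= in_itv/= andbT lee_fin => /(trawl_ge0 ta).
rewrite (ae_eq_integral (fun w => (L (trawl_set a t) w ^+ 2)%:E))//.
- apply/measurable_EFinP; apply: measurable_funX.
  exact: measurable_trawl_process.
- exact/measurable_EFinP/measurable_funX.
- by apply: filterS (tX.2 t) => w + _ /= => ->.
Qed.

(** Almost surely the contributions of the common part of [A_t] and [A_s] cancel, so the increment
    is [p - q] with [p] and [q] the values of [L] on the two differences. Then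
    [(p - q)^2 <= 2 p^2 + 2 q^2], whence the factor 4. *)
Lemma trawl_process_increment :
  exists2 C : R, 0 <= C & forall s t, `|t - s| <= 1 ->
    (\int[P]_w ((X t w - X s w) ^+ 2)%:E <= (C * `|t - s|)%:E)%E.
Proof.
have [K K0 hK] := levy_basis_second_moment lL sL' L'oo.
have a0 : 0 <= a 0 by exact: trawl_ge0.
exists (4 * (K * (a 0 + a 0 ^+ 2))).
  by rewrite !mulr_ge0// addr_ge0// sqr_ge0.
move=> s t st1.
have mA u : measurable (trawl_set a u) by exact: measurable_trawl_set.
have mAD u v : measurable (trawl_set a u `\` trawl_set a v) by exact: measurableD.
have mAI u v : measurable (trawl_set a u `&` trawl_set a v) by exact: measurableI.
have fA u := borel_finite_trawl_set ta u.
have fAD u v : borel_finite (trawl_set a u `\` trawl_set a v).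
  exact: borel_finite_subset (mAD u v) (@subDsetl _ _ _) (fA u).
have fAI u v : borel_finite (trawl_set a u `&` trawl_set a v).
  exact: borel_finite_subset (mAI u v) (@subIsetl _ _ _) (fA u).
have decomp u v : {ae P, forall w, L (trawl_set a u) w =
    L (trawl_set a u `\` trawl_set a v) w + L (trawl_set a u `&` trawl_set a v) w}.
  have := levy_basisU lL (fAD u v) (fAI u v).
  rewrite setUC setUIDK; apply => //.
  by rewrite setIC -setIA setDE [_ `&` (_ `&` ~` _)]setIC -setIA setICl !setI0.
pose D u v w := L (trawl_set a u `\` trawl_set a v) w.
have mD2 u v : measurable_fun setT (fun w => (D u v w ^+ 2)%:E).
  exact/measurable_EFinP/measurable_funX.
have momD u v : `|v - u| <= 1 ->
    (\int[P]_w (D u v w ^+ 2)%:E <= (K * (a 0 + a 0 ^+ 2) * `|v - u|)%:E)%E.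
  move=> uv1.
  have lD : (lebesgue2 (trawl_set a u `\` trawl_set a v) <= (a 0 * `|v - u|)%:E)%E.
    have [uv|vu] := leP u v.
      by rewrite lebesgue2_trawl_setDC// ger0_norm ?subr_ge0// lebesgue2_trawl_setD.
    by rewrite ltr0_norm ?subr_lt0// opprB lebesgue2_trawl_setD// ltW.
  apply: (le_trans (hK _ _ (fAD u v) lD)); rewrite lee_fin -mulrA ler_wpM2l//.
  (* Since [|v - u| <= 1], the term quadratic in the area is absorbed into a linear one. *)
  rewrite mulrDl lerD// exprMn ler_wpM2l ?sqr_ge0// expr2 ler_piMl//.
rewrite -mulrA.
have : {ae P, forall w, setT w ->
    (((X t w - X s w) ^+ 2)%:E <= 2%:E * (D t s w ^+ 2)%:E + 2%:E * (D s t w ^+ 2)%:E)%E}.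
  near=> w => _.
  have -> : X t w = L (trawl_set a t) w by near: w; exact: (tX.2 t).
  have -> : X s w = L (trawl_set a s) w by near: w; exact: (tX.2 s).
  have -> : L (trawl_set a t) w = D t s w + L (trawl_set a t `&` trawl_set a s) w.
    by near: w; exact: decomp.
  have -> : L (trawl_set a s) w = D s t w + L (trawl_set a t `&` trawl_set a s) w.
    by near: w; rewrite (setIC (trawl_set a t)); exact: decomp.
  rewrite -!EFinM -EFinD lee_fin.
  have := sqr_ge0 (D t s w + D s t w); nra.
move=> ae1.
apply: (@le_trans _ _ (\int[P]_w (2%:E * (D t s w ^+ 2)%:E + 2%:E * (D s t w ^+ 2)%:E))%E).
  apply: ae_ge0_le_integral => //.
  - by move=> w _; rewrite lee_fin sqr_ge0.
  - apply/measurable_EFinP/measurable_funX; apply: measurable_funB;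
      exact: measurable_trawl_process.
  - by move=> w _; rewrite -!EFinM -EFinD lee_fin addr_ge0// mulr_ge0// sqr_ge0.
  - by apply: emeasurable_funD; exact: measurable_funeM.
have nD u v w : setT w -> (0 <= 2%:E * (D u v w ^+ 2)%:E)%E.
  by move=> _; rewrite -EFinM lee_fin mulr_ge0// sqr_ge0.
have mD u v : measurable_fun setT (fun w => (2%:E * (D u v w ^+ 2)%:E)%E).
  exact: measurable_funeM.
rewrite (ge0_integralD _ _ (@nD t s) (mD t s) (@nD s t) (mD s t))//.
rewrite !ge0_integralZl//; try by move=> *; rewrite lee_fin sqr_ge0.
have h1 := momD s t st1.
have h2 : (\int[P]_w (D t s w ^+ 2)%:E <= (K * (a 0 + a 0 ^+ 2) * `|t - s|)%:E)%E.
  by rewrite -normrN opprB; apply: momD; rewrite -normrN opprB.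
apply: (le_trans (leeD (lee_wpmul2l _ h2) (lee_wpmul2l _ h1))).
- by rewrite lee_fin.
- by rewrite lee_fin.
by rewrite -!EFinM -EFinD lee_fin; lra.
Unshelve. all: by end_near. Qed.

End trawl_process_moments.

(** * Riemann sums along a path *)

Section tonelli.
Variables (R : realType) (d : measure_display) (T : measurableType d).
Variable P : probability T R.

Let mkcond (D : set R) (f : R * T -> R) (w : T) :
  (\int[lebesgue_measure]_(s in D) (f (s, w))%:E =
   \int[lebesgue_measure]_s (f (s, w) * \1_D s)%:E)%E.
Proof.
rewrite integral_mkcond; apply: eq_integral => s _.
by rewrite patchE indicE; case: ifPn; rewrite ?mulr1 ?mulr0.
Qed.

Variables (D : set R) (f : R * T -> R).
Hypothesis mD : measurable D.
Hypothesis mf : measurable_fun setT f.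
Hypothesis f0 : forall p, 0 <= f p.

(** The indicator moves the restriction to [D] into the integrand, so that Tonelli's theorem can be
    applied on the full product space. *)
Let F : measurableTypeR R * T -> \bar R := fun p => (f p * \1_D p.1)%:E.

Let mF : measurable_fun setT F.
Proof.
apply/measurable_EFinP; apply: measurable_funM => //.
by apply: measurableT_comp => //; apply: measurable_indic.
Qed.

Let F0 p : (0 <= F p)%E.
Proof. by rewrite lee_fin mulr_ge0. Qed.

Lemma measurable_integral_section :
  measurable_fun setT (fun w => \int[lebesgue_measure]_(s in D) (f (s, w))%:E)%E.
Proof.
rewrite (_ : (fun _ => _) = fubini_G (@lebesgue_measure R) F); last first.
  by apply/funext => w; rewrite mkcond.
exact: (measurable_fun_fubini_tonelli_G F mF F0).
Qed.

Lemma tonelli_section :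
  (\int[P]_w \int[lebesgue_measure]_(s in D) (f (s, w))%:E =
   \int[lebesgue_measure]_(s in D) \int[P]_w (f (s, w))%:E)%E.
Proof.
under eq_integral do rewrite mkcond.
rewrite -[LHS](@fubini_tonelli _ _ _ _ _ (@lebesgue_measure R) P F mF F0).
rewrite [RHS]integral_mkcond; apply: eq_integral => s _.
rewrite patchE /F/=; case: ifPn => sD.
  by apply: eq_integral => w _; rewrite indicE sD mulr1.
by apply: integral0_eq => w _; rewrite indicE (negbTE sD) mulr0.
Qed.

End tonelli.

Section riemann_sum_bound.
Variables (R : realType) (g : R -> R).
Hypothesis mg : measurable_fun setT g.
Local Notation leb := (@lebesgue_measure R).

Let mitv (i : interval R) : measurable ([set` i] : set (measurableTypeR R)).
Proof. exact: measurable_itv. Qed.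

Lemma Rintegral_cst_itvoc (x y c : R) : x <= y ->
  \int[leb]_(s in `]x, y]) c = c * (y - x).
Proof.
move=> xy; rewrite Rintegral_cst//; congr (_ * _).
have := @lebesgue_measure_itv R `]x, y].
rewrite /= lte_fin => /(congr1 fine) e; apply: (etrans e).
by case: ltgtP xy => //= -> _; rewrite subrr.
Qed.

(** A substitute for the Cauchy-Schwarz inequality without square roots: after integration the first
    term is small on short intervals, the second for large [M]. *)
Lemma norm_le_sqr (M x : R) : 0 < M -> `|x| <= M + M^-1 * x ^+ 2.
Proof.
move=> M0; rewrite -(ler_pM2l M0) mulrDr mulrA mulfV ?gt_eqF// mul1r.
rewrite -(real_normK (num_real x)); have : 0 <= `|x| by []; set y := `|x|.
by have := sqr_ge0 (M - y); nra.
Qed.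

Variable K : R.
Hypothesis g2oo : (\int[leb]_(s in `[0%R, K]) (g s ^+ 2)%:E < +oo)%E.

Lemma integrable_sqr : leb.-integrable `[0, K] (EFin \o (fun s => g s ^+ 2)).
Proof.
apply/integrableP; split.
  by apply/measurable_EFinP; apply: measurable_funX; exact: measurable_funTS.
under eq_integral do rewrite /= ger0_norm ?sqr_ge0//.
exact: g2oo.
Qed.

Lemma integrable_cst_itv (i : interval R) (c : R) : [set` i] `<=` `[0, K] ->
  leb.-integrable [set` i] (EFin \o (fun=> c)).
Proof.
move=> iK; apply: (@integrableS _ _ _ leb `[0, K]) => //.
apply: continuous_compact_integrable => //; first exact: segment_compact.
by move=> x; apply: cst_continuous.
Qed.

Lemma integrable_of_sqr : leb.-integrable `[0, K] (EFin \o g).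
Proof.
have i1 : leb.-integrable `[0, K] (EFin \o (fun s => 1 + g s ^+ 2)).
  have icst : leb.-integrable `[0, K] (EFin \o (fun=> 1)) by exact: integrable_cst_itv.
  have := integrableD (mitv `[0, K])
    icst integrable_sqr.
  by apply: eq_integrable => //; exact: measurable_itv.
apply: le_integrable i1 => //.
  by apply/measurable_EFinP; exact: measurable_funTS.
move=> s _; rewrite /= lee_fin (le_trans (norm_le_sqr (g s) ltr01))//.
by rewrite invr1 mul1r ler_norm.
Qed.

(** The quadratic term is integrated over all of [[0, K]], which makes it independent of [x] and
    [y]; this is the source of uniformity in time. *)
Lemma Rintegral_increment_le (M x y : R) : 0 < M -> 0 <= x <= y -> y <= K ->
  `|\int[leb]_(s in `[0, y]) g s - \int[leb]_(s in `[0, x]) g s| <=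
  M * (y - x) + M^-1 * \int[leb]_(s in `[0, K]) (g s ^+ 2).
Proof.
move=> M0 /andP[x0 xy] yK.
have subK : `]x, y]%classic `<=` `[0, K]%classic.
  by move=> s /=; rewrite !in_itv/= => /andP[? ?]; apply/andP; split; lra.
have subyK : `[0, y]%classic `<=` `[0, K]%classic.
  by move=> s /=; rewrite !in_itv/= => /andP[? ?]; apply/andP; split; lra.
have ig := integrable_of_sqr.
have igxy : leb.-integrable `]x, y] (EFin \o g).
  by apply: integrableS ig => //; exact: measurable_itv.
have ig2xy : leb.-integrable `]x, y] (EFin \o (fun s => g s ^+ 2)).
  by apply: integrableS integrable_sqr => //; exact: measurable_itv.
have icxy : leb.-integrable `]x, y] (EFin \o (fun=> M)) by exact: integrable_cst_itv.
have iM2 : leb.-integrable `]x, y] (EFin \o (fun s => M^-1 * g s ^+ 2)).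
  have := integrableZl (mitv `]x, y])
    M^-1 ig2xy.
  by apply: eq_integrable => //; exact: measurable_itv.
rewrite Rintegral_itvB ?bnd_simp//; last first.
  by apply: integrableS ig => //; exact: measurable_itv.
apply: (le_trans (le_normr_Rintegral (mitv _) igxy)).
apply: (@le_trans _ _ (\int[leb]_(s in `]x, y]) (M + M^-1 * g s ^+ 2))).
  apply: le_Rintegral => //; first exact: (integrable_norm igxy).
    have := integrableD (mitv `]x, y])
      icxy iM2.
    by apply: eq_integrable => //; exact: measurable_itv.
  by move=> s _; exact: norm_le_sqr.
rewrite RintegralD// RintegralZl//; apply: lerD.
  by rewrite Rintegral_cst_itvoc.
apply: ler_wpM2l; first by rewrite invr_ge0 ltW.
rewrite /Rintegral fine_le//.
- by apply: integrable_fin_num => //; exact: ig2xy.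
- by apply: integrable_fin_num => //; exact: integrable_sqr.
apply: ge0_subset_integral => //.
  by apply/measurable_EFinP; apply: measurable_funX; exact: measurable_funTS.
by move=> s _; rewrite lee_fin sqr_ge0.
Qed.

(** By induction on [j]: a new cell has length [Delta], so its term [Delta * g x] minus the integral
    of [g] over the cell is the integral of [g x - g s]. *)
Lemma riemann_sum_le (Delta : R) (j : nat) : 0 <= Delta -> j%:R * Delta <= K ->
  `|Delta * (\sum_(0 <= k < j) g (k%:R * Delta)) -
    \int[leb]_(s in `[0, j%:R * Delta]) g s| <=
  \sum_(0 <= k < j)
    \int[leb]_(s in `]k%:R * Delta, k.+1%:R * Delta]) `|g (k%:R * Delta) - g s|.
Proof.
move=> D0; elim: j => [|j IH] jK.
  by rewrite !big_nil mul0r mulr0 set_itv1 Rintegral_set1 subr0 normr0.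
have jj : j%:R * Delta <= j.+1%:R * Delta by rewrite ler_wpM2r// ler_nat.
have j0 : 0 <= j%:R * Delta by rewrite mulr_ge0.
have {}IH := IH (le_trans jj jK).
rewrite !big_nat_recr//= mulrDr.
set S := \sum_(0 <= k < j) _ in IH *; set S' := \sum_(0 <= k < j) _ in IH *.
set x := j%:R * Delta in jj j0 IH *; set y := j.+1%:R * Delta in jK jj *.
have subK : `]x, y]%classic `<=` `[0, K]%classic.
  by move=> s /=; rewrite !in_itv/= => /andP[? ?]; apply/andP; split; lra.
have igxy : leb.-integrable `]x, y] (EFin \o g).
  by apply: integrableS integrable_of_sqr => //; exact: measurable_itv.
have icxy : leb.-integrable `]x, y] (EFin \o (fun=> g x)) by exact: integrable_cst_itv.
have iB : leb.-integrable `]x, y] (EFin \o (fun s => g x - g s)).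
  have := integrableB (mitv `]x, y])
    icxy igxy.
  by apply: eq_integrable => //; exact: measurable_itv.
have e1 : \int[leb]_(s in `[0, y]) g s = \int[leb]_(s in `[0, x]) g s +
    \int[leb]_(s in `]x, y]) g s.
  rewrite -(@Rintegral_itvB _ g (BLeft 0) (BRight y) x) ?bnd_simp//; first by rewrite addrC subrK.
  apply: integrableS integrable_of_sqr => //; try exact: measurable_itv.
  by move=> s /=; rewrite !in_itv/= => /andP[? ?]; apply/andP; split; lra.
have e2 : Delta * g x = \int[leb]_(s in `]x, y]) (g x - g s) + \int[leb]_(s in `]x, y]) g s.
  rewrite RintegralB// subrK Rintegral_cst_itvoc// mulrC.
  by rewrite /x /y -natr1; congr (_ * _); ring.
rewrite e1 e2.
have -> (p q r s : R) : p + (q + r) - (s + r) = (p - s) + q by ring.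
by apply: (le_trans (ler_normD _ _)); rewrite lerD// le_normr_Rintegral.
Qed.

End riemann_sum_bound.

(** * Processes that are Lipschitz in quadratic mean *)

Section l2_lipschitz_process.
Variables (R : realType) (d : measure_display) (T : measurableType d).
Variables (P : probability T R) (Z : R -> T -> R) (C : R).
Local Notation leb := (@lebesgue_measure R).
Hypothesis mZ : measurable_fun [set: R * T] (fun p : R * T => Z p.1 p.2).
Hypothesis C0 : 0 <= C.
Hypothesis Z2 : forall t, (\int[P]_w (Z t w ^+ 2)%:E <= C%:E)%E.
Hypothesis Zinc : forall s t, `|t - s| <= 1 ->
  (\int[P]_w ((Z t w - Z s w) ^+ 2)%:E <= (C * `|t - s|)%:E)%E.

Lemma measurable_process_time (t : R) : measurable_fun setT (Z t).
Proof. exact: measurableT_comp mZ (@pair1_measurable _ _ _ _ t). Qed.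

Lemma measurable_process_path (w : T) : measurable_fun setT (Z^~ w).
Proof. exact: measurableT_comp mZ (@pair2_measurable _ _ _ _ w). Qed.

Let itvk (Delta : R) (k : nat) : set R := `]k%:R * Delta, k.+1%:R * Delta]%classic.

(** Extended-real integrals of nonnegative functions make this meaningful on every path and open to
    Tonelli's theorem. *)
Definition riemann_error (Delta : R) (N : nat) (w : T) : \bar R :=
  (\sum_(0 <= k < N) \int[leb]_(s in itvk Delta k) (`|Z (k%:R * Delta) w - Z s w|)%:E)%E.

Definition path_energy (K : R) (w : T) : \bar R :=
  (\int[leb]_(s in `[0%R, K]) (Z s w ^+ 2)%:E)%E.

(** No time variable occurs here: one random variable dominates the errors at all times, which turns
    a supremum into a single expectation. *)
Definition error_bound (Delta K M delta : R) (N : nat) (w : T) : \bar R :=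
  (riemann_error Delta N w + (M * delta)%:E + M^-1%:E * path_energy K w)%E.

Lemma riemann_error_ge0 Delta N w : (0 <= riemann_error Delta N w)%E.
Proof. by apply: sume_ge0 => k _; apply: integral_ge0 => s _; rewrite lee_fin. Qed.

Lemma path_energy_ge0 K w : (0 <= path_energy K w)%E.
Proof. by apply: integral_ge0 => s _; rewrite lee_fin sqr_ge0. Qed.

Let mDelta Delta k : measurable_fun setT
  (fun p : R * T => `|Z (k%:R * Delta) p.2 - Z p.1 p.2|).
Proof.
apply: measurableT_comp => //; apply: measurable_funB => //.
by apply: measurableT_comp (measurable_process_time _) _.
Qed.

Let mSq : measurable_fun setT (fun p : R * T => Z p.1 p.2 ^+ 2).
Proof. exact: measurable_funX. Qed.

Lemma measurable_riemann_error Delta N : measurable_fun setT (riemann_error Delta N).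
Proof.
apply: emeasurable_sum => k _.
exact: (measurable_integral_section (measurable_itv _) (mDelta Delta k)
    (fun p => normr_ge0 _)).
Qed.

Lemma measurable_path_energy K : measurable_fun setT (path_energy K).
Proof.
exact: (measurable_integral_section (measurable_itv _) mSq (fun p => sqr_ge0 _)).
Qed.

Lemma measurable_error_bound Delta K M delta N :
  measurable_fun setT (error_bound Delta K M delta N).
Proof.
apply: emeasurable_funD.
  apply: emeasurable_funD => //; exact: measurable_riemann_error.
apply: measurable_funeM; exact: measurable_path_energy.
Qed.

(** This is [norm_le_sqr] at [M^-1], integrated. With this choice the term free of [|t - s|]
    vanishes as [M] grows, and the other one as the mesh shrinks for fixed [M]. *)
Lemma abs_increment_le (M s t : R) : 0 < M -> `|t - s| <= 1 ->
  (\int[P]_w (`|Z t w - Z s w|)%:E <= (M^-1 + M * (C * `|t - s|))%:E)%E.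
Proof.
move=> M0 st1.
have mts : measurable_fun setT (fun w => Z t w - Z s w).
  by apply: measurable_funB; exact: measurable_process_time.
have mts2 : measurable_fun setT (fun w => ((Z t w - Z s w) ^+ 2)%:E).
  exact/measurable_EFinP/measurable_funX.
apply: (@le_trans _ _ (\int[P]_w (M^-1%:E + M%:E * ((Z t w - Z s w) ^+ 2)%:E))%E).
  apply: ge0_le_integral => //.
  - by apply/measurable_EFinP; exact: measurableT_comp.
  - by apply: emeasurable_funD => //; exact: measurable_funeM.
  - move=> w _; rewrite -EFinM -EFinD lee_fin.
    have Mi : 0 < M^-1 by rewrite invr_gt0.
    by have := norm_le_sqr (Z t w - Z s w) Mi; rewrite invrK.
rewrite ge0_integralD//; last 3 first.
- by move=> w _; rewrite lee_fin invr_ge0 ltW.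
- by move=> w _; rewrite -EFinM lee_fin mulr_ge0 ?sqr_ge0 ?ltW.
- exact: measurable_funeM.
rewrite integral_cst// [X in (_ * X)%E]probability_setT mule1 EFinD leeD2l//.
rewrite ge0_integralZl//; last 2 first.
- by move=> w _; rewrite lee_fin sqr_ge0.
- by rewrite lee_fin ltW.
by rewrite EFinM lee_wpmul2l ?lee_fin ?(ltW M0)//; exact: Zinc.
Qed.

(** By Tonelli each cell contributes its length [Delta] times a bound on the mean absolute increment
    over a distance of at most [Delta]. *)
Lemma integral_riemann_error_le (M Delta : R) N : 0 < M -> 0 <= Delta <= 1 ->
  (\int[P]_w riemann_error Delta N w <=
   (N%:R * Delta * (M^-1 + M * (C * Delta)))%:E)%E.
Proof.
move=> M0 /andP[D0 D1].
rewrite /riemann_error ge0_integral_sum//; last 2 first.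
- move=> k; exact: (measurable_integral_section (measurable_itv _) (mDelta Delta k)
    (fun p => normr_ge0 _)).
- by move=> k w _; apply: integral_ge0 => s _; rewrite lee_fin.
apply: (@le_trans _ _ (\sum_(0 <= k < N) (Delta * (M^-1 + M * (C * Delta)))%:E)%E).
  apply: lee_sum => k _.
  have -> := tonelli_section P (measurable_itv `]k%:R * Delta, k.+1%:R * Delta])
    (mDelta Delta k) (fun p => normr_ge0 _).
  apply: (@le_trans _ _ (\int[leb]_(s in itvk Delta k) (M^-1 + M * (C * Delta))%:E)%E).
    apply: ge0_le_integral => //.
    - by move=> s _; apply: integral_ge0 => w _; rewrite lee_fin.
    - apply: measurable_funTS.
      apply: (measurable_fun_fubini_tonelli_F
        (fun p : measurableTypeR R * T => (`|Z (k%:R * Delta) p.2 - Z p.1 p.2|)%:E)) => //.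
      by apply/measurable_EFinP; exact: mDelta.
    - move=> s; rewrite /itvk/= in_itv/= -natr1 mulrDl mul1r => /andP[s1 s2].
      have hs : `|k%:R * Delta - s| <= Delta.
        by rewrite ler0_norm; lra.
      apply: (le_trans (abs_increment_le M0 (le_trans hs D1))).
      rewrite lee_fin lerD2l; apply: ler_wpM2l; first exact: ltW.
      exact: ler_wpM2l.
  have e0 : 0 <= M^-1 + M * (C * Delta).
    by rewrite addr_ge0 ?invr_ge0 ?(ltW M0)// !mulr_ge0// ltW.
  rewrite integral_cst; last exact: measurable_itv.
  rewrite [X in (_ * X)%E](_ : _ = Delta%:E); first by rewrite -EFinM mulrC.
  apply: (etrans (lebesgue_measure_itv `]k%:R * Delta, k.+1%:R * Delta])).
  rewrite /= lte_fin -natr1 mulrDl mul1r ltrDl.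
  case: ifPn => [_|]; first by rewrite -EFinB; congr EFin; ring.
  by rewrite -leNgt => D0'; congr EFin; apply/eqP; rewrite eq_le D0 D0'.
by rewrite sumEFin lee_fin big_const_nat subn0 iter_addr_0 -[leLHS]mulr_natl [leLHS]mulrA.
Qed.

Lemma integral_path_energy_le (K : R) : 0 <= K ->
  (\int[P]_w path_energy K w <= (K * C)%:E)%E.
Proof.
move=> K0.
have -> := tonelli_section P (measurable_itv `[0, K]) mSq (fun p => sqr_ge0 _).
apply: (@le_trans _ _ (\int[leb]_(s in `[0%R, K]) C%:E)%E).
  apply: ge0_le_integral => //.
  - by move=> s _; apply: integral_ge0 => w _; rewrite lee_fin sqr_ge0.
  - apply: measurable_funTS.
    apply: (measurable_fun_fubini_tonelli_F
      (fun p : measurableTypeR R * T => (Z p.1 p.2 ^+ 2)%:E)) => //.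
      by apply/measurable_EFinP; exact: mSq.
    by move=> p; rewrite lee_fin sqr_ge0.
  - by move=> s _; exact: Z2.
rewrite integral_cst; last exact: measurable_itv.
rewrite [X in (_ * X)%E](_ : _ = K%:E); first by rewrite -EFinM mulrC.
apply: (etrans (lebesgue_measure_itv `[0, K])).
by rewrite /= lte_fin oppr0 adde0; case: ltgtP K0 => // <-.
Qed.

Lemma integral_error_bound_le (Delta K M delta : R) N : 0 < M -> 0 <= Delta <= 1 ->
  0 <= delta -> 0 <= K -> N%:R * Delta <= K ->
  (\int[P]_w error_bound Delta K M delta N w <=
   (K * (M^-1 + M * (C * Delta)) + M * delta + M^-1 * (K * C))%:E)%E.
Proof.
move=> M0 D01 delta0 K0 NK.
rewrite /error_bound.
have h1 : (0 <= (M * delta)%:E)%E by rewrite lee_fin mulr_ge0// ltW.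
have h2 : (0 <= M^-1%:E)%E by rewrite lee_fin invr_ge0 ltW.
rewrite ge0_integralD//; last 4 first.
- by move=> w _; rewrite adde_ge0// riemann_error_ge0.
- by apply: emeasurable_funD => //; exact: measurable_riemann_error.
- by move=> w _; rewrite mule_ge0// path_energy_ge0.
- by apply: measurable_funeM; exact: measurable_path_energy.
rewrite ge0_integralD//; last 2 first.
- by move=> w _; exact: riemann_error_ge0.
- exact: measurable_riemann_error.
rewrite integral_cst// [X in ((M * delta)%:E * X)%E]probability_setT mule1.
rewrite ge0_integralZl//; last 2 first.
- exact: measurable_path_energy.
- by move=> w _; exact: path_energy_ge0.
rewrite !EFinD; apply: leeD; first apply: leeD => //.
  apply: (le_trans (integral_riemann_error_le N M0 D01)).
  rewrite lee_fin ler_wpM2r//.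
  by case/andP: D01 => D0 _; rewrite addr_ge0 ?invr_ge0 ?(ltW M0)// !mulr_ge0// ltW.
by rewrite EFinM lee_wpmul2l//; exact: integral_path_energy_le.
Qed.

(** The triangle inequality through the integral up to [j * Delta] separates the Riemann sum error
    from the mismatch of the endpoints. *)
Lemma path_error_le (Delta K M delta tau : R) (j N : nat) (w : T) : 0 < M ->
  0 <= Delta -> N%:R * Delta <= K -> (j <= N)%N -> 0 <= tau <= K ->
  `|j%:R * Delta - tau| <= delta ->
  ((`|Delta * (\sum_(0 <= k < j) Z (k%:R * Delta) w) -
     \int[leb]_(s in `[0, tau]) Z s w|)%:E <= error_bound Delta K M delta N w)%E.
Proof.
move=> M0 D0 NK jN /andP[tau0 tauK] hd.
rewrite /error_bound.
(* On a path that is not square integrable the bound is infinite; on the others the real-valued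
   integrals are genuine. *)
have [E|E] := eqVneq (path_energy K w) +oo%E.
  rewrite E gt0_muley ?lte_fin ?invr_gt0// addey ?leey//.
  by rewrite gt_eqF// (lt_le_trans (ltNyr 0))// adde_ge0 ?riemann_error_ge0//
     lee_fin mulr_ge0 ?(ltW M0)// (le_trans _ hd).
have Eoo : (path_energy K w < +oo)%E by rewrite ltey.
have mg := measurable_process_path w.
have K0 : 0 <= K by exact: le_trans tauK.
have jK : j%:R * Delta <= K.
  by apply: le_trans NK; rewrite ler_wpM2r// ler_nat.
have j0 : 0 <= j%:R * Delta by rewrite mulr_ge0.
have ei : path_energy K w = (\int[leb]_(s in `[0, K]) (Z s w ^+ 2))%:E.
  by rewrite /Rintegral fineK// ge0_fin_numE//; exact: path_energy_ge0.
have h1 := riemann_sum_le mg Eoo D0 jK.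
have h2 : `|\int[leb]_(s in `[0, tau]) Z s w - \int[leb]_(s in `[0, j%:R * Delta]) Z s w| <=
   M * delta + M^-1 * \int[leb]_(s in `[0, K]) (Z s w ^+ 2).
  have [jt|tj] := leP (j%:R * Delta) tau.
    apply: (le_trans (Rintegral_increment_le mg Eoo M0 _ tauK)); first by rewrite j0.
    rewrite lerD2r ler_pM2l// (le_trans _ hd)//.
    by rewrite -normrN opprB ler_norm.
  rewrite distrC; apply: (le_trans (Rintegral_increment_le mg Eoo M0 _ jK)).
    by rewrite tau0 ltW.
  by rewrite lerD2r ler_pM2l// (le_trans _ hd)// ler_norm.
(* The cells from [j] to [N] only add nonnegative terms, so the sum over all [N] cells serves every
   [j <= N]. *)
have h3 : ((\sum_(0 <= k < j) \int[leb]_(s in itvk Delta k) `|Z (k%:R * Delta) w - Z s w|)%:E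
    <= riemann_error Delta N w)%E.
  rewrite /riemann_error (big_cat_nat (leq0n j) jN)/= -sumEFin.
  apply: (@le_trans _ _ (\sum_(0 <= k < j)
    \int[leb]_(s in itvk Delta k) (`|Z (k%:R * Delta) w - Z s w|)%:E)%E); last first.
    by rewrite leeDl// sume_ge0// => k _; apply: integral_ge0 => s _; rewrite lee_fin.
  rewrite le_eqVlt; apply/orP; left; apply/eqP.
  rewrite big_nat [RHS]big_nat; apply: eq_bigr => k /andP[_ kj].
  rewrite /Rintegral fineK//.
  have kK : k.+1%:R * Delta <= K.
    by apply: le_trans jK; rewrite ler_wpM2r// ler_nat.
  have k0 : 0 <= k%:R * Delta by rewrite mulr_ge0.
  have subK : itvk Delta k `<=` `[0, K]%classic.
    by move=> s /=; rewrite /itvk/= !in_itv/= => /andP[? ?]; apply/andP; split; lra.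
  have mI : measurable (itvk Delta k : set (measurableTypeR R)) by exact: measurable_itv.
  have ig : leb.-integrable (itvk Delta k) (EFin \o (Z^~ w)).
    by apply: integrableS (integrable_of_sqr mg Eoo) => //; exact: measurable_itv.
  have ic : leb.-integrable (itvk Delta k) (EFin \o (fun=> Z (k%:R * Delta) w)).
    exact: (integrable_cst_itv _ subK).
  apply: integrable_fin_num => //.
  exact: (integrable_norm (integrableB mI ic ig)).
rewrite ei -addeA -EFinM -EFinD.
apply: (le_trans _ (leeD h3 (le_refl _))).
rewrite -EFinD lee_fin; apply: le_trans (lerD h1 h2).
by apply: le_trans (ler_normB _ _); rewrite opprB addrA subrK.
Qed.

End l2_lipschitz_process.

(** * Measurability of the supremum *)

(** The extended integral of a measurable function that is not integrable is infinite, and [fine]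
    sends both infinities to 0. *)
Lemma Rintegral_nonintegrable (R : realType) (d : measure_display)
    (T : measurableType d) (m : {measure set T -> \bar R}) (D : set T) (f : T -> R) :
  measurable D -> measurable_fun D f -> ~ m.-integrable D (EFin \o f) ->
  \int[m]_(x in D) f x = 0.
Proof.
move=> mD mf nint; rewrite /Rintegral.
case E : (\int[m]_(x in D) (f x)%:E)%E => [r| |] //=.
case: nint; apply/integrableP; split; first exact/measurable_EFinP.
by have := integral_fin_num_abs m mD mf; rewrite E.
Qed.

(** For [n > 0] and [t] irrational, [n t] is not an integer; the radius is its distance to the two
    neighbouring integers divided by [n]. *)
Lemma truncn_locally_constant (R : realType) (n : nat) (t : R) : 0 < t ->
  (forall q : rat, t != ratr q) ->
  exists2 r : R, 0 < r & forall t' : R, `|t' - t| < r ->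
    Num.truncn (n%:R * t') = Num.truncn (n%:R * t).
Proof.
move=> t0 tq; case: n => [|n].
  by exists 1 => // t' _; rewrite !mul0r.
have n0 : 0 < n.+1%:R :> R by [].
set x := n.+1%:R * t; have x0 : 0 <= x by rewrite mulr_ge0// ltW.
have /andP[lo hi] := truncn_itv x0.
have lo' : (Num.truncn x)%:R < x.
  rewrite lt_neqAle lo andbT; apply/eqP => e.
  have /eqP[] := tq ((Num.truncn x)%:R / n.+1%:R).
  by rewrite rmorph_div/= ?unitfE ?pnatr_eq0// !ratr_nat e /x mulrC mulKf// pnatr_eq0.
pose r := Num.min (x - (Num.truncn x)%:R) ((Num.truncn x).+1%:R - x) / n.+1%:R.
exists r; first by rewrite divr_gt0// lt_min !subr_gt0 lo'.
move=> t'; rewrite ltr_pdivlMr// lt_min => /andP[h1 h2].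
have e : n.+1%:R * t' = x + (t' - t) * n.+1%:R by rewrite /x; ring.
have := ler_norm (t' - t); have := ler_norm (- (t' - t)); rewrite normrN => a1 a2.
have a3 : (t' - t) * n.+1%:R <= `|t' - t| * n.+1%:R by rewrite ler_wpM2r.
have a4 : - (t' - t) * n.+1%:R <= `|t' - t| * n.+1%:R by rewrite ler_wpM2r.
rewrite mulNr in a4.
have hx : (Num.truncn x)%:R <= n.+1%:R * t' < (Num.truncn x).+1%:R.
  by rewrite e; apply/andP; split; lra.
apply/eqP; rewrite truncn_eq//.
by apply: le_trans (proj1 (andP hx)).
Qed.

Section measurable_supremum.
Variables (R : realType) (d : measure_display) (T : measurableType d).
Variable Z : R -> T -> R.
Local Notation leb := (@lebesgue_measure R).
Hypothesis mZ : measurable_fun [set: R * T] (fun p : R * T => Z p.1 p.2).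

Let mpath (w : T) : measurable_fun setT (Z^~ w).
Proof. exact: measurableT_comp mZ (@pair2_measurable _ _ _ _ w). Qed.

(** Tonelli's theorem covers nonnegative integrands, so the positive and negative parts are treated
    separately; [fine] preserves measurability. *)
Lemma measurable_Rintegral_section (D : set R) : measurable D ->
  measurable_fun setT (fun w => \int[leb]_(s in D) Z s w).
Proof.
move=> mD; rewrite /Rintegral.
apply: (measurableT_comp (@fine_measurable R setT measurableT)).
under eq_fun do rewrite integralE.
apply: emeasurable_funB.
- have mp : measurable_fun setT (fun p : R * T => Num.max (Z p.1 p.2) 0).
    exact: measurable_maxr.
  have p0 (p : R * T) : 0 <= Num.max (Z p.1 p.2) 0 by rewrite le_max lexx orbT.
  have := measurable_integral_section mD mp p0.
  apply: eq_measurable_fun => w _; apply: eq_integral => s _.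
  by rewrite funeposE EFin_max.
- have mp : measurable_fun setT (fun p : R * T => Num.max (- Z p.1 p.2) 0).
    by apply: measurable_maxr => //; exact: measurableT_comp.
  have p0 (p : R * T) : 0 <= Num.max (- Z p.1 p.2) 0 by rewrite le_max lexx orbT.
  have := measurable_integral_section mD mp p0.
  apply: eq_measurable_fun => w _; apply: eq_integral => s _.
  by rewrite funenegE EFin_max.
Qed.

Variables (Delta mu V : R) (n : nat).
Hypothesis mu0 : 0 < mu.
Hypothesis V0 : 0 < V.

Let F (t : R) (w : T) : R :=
  `|Delta * (\sum_(0 <= k < Num.truncn (n%:R * t)) Z (k%:R * Delta) w) -
    \int[leb]_(s in `[0, t * mu]) Z s w|.

(* The supremum over [[0, V]] is reached along the rational times and [V]. At an
   irrational time [t], [[nt]] is locally constant and the integral is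
   left-continuous in [t] if the path is integrable on [[0, t mu]]; otherwise
   [Rintegral] has the junk value [0] at [t] and at all later times. *)
Let q (k : nat) : R := if unpickle k is Some r then
  (if 0 <= (ratr r : R) <= V then ratr r else V) else V.

Let q_itv k : 0 <= q k <= V.
Proof.
rewrite /q; case: unpickle => [r|]; last by rewrite ltW//=.
by case: ifPn => // _; rewrite ltW/=.
Qed.

Let q_rat (r : rat) : 0 <= (ratr r : R) <= V -> exists k, q k = ratr r.
Proof. by move=> rV; exists (pickle r); rewrite /q pickleK rV. Qed.

Let q_V : exists k, q k = V.
Proof.
(* A rational above [V] falls into the default branch of [q]. *)
have [s] := @rat_in_itvoo R V (V + 1) (ltr_pwDr ltr01 (lexx V)).
rewrite in_itv/= => /andP[Vs _]; exists (pickle s); rewrite /q pickleK.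
by rewrite [_ <= V]leNgt Vs/= andbF.
Qed.

Let S w : \bar R := ereal_sup (range (fun k => (F (q k) w)%:E)).

Let F_le_S k w : ((F (q k) w)%:E <= S w)%E.
Proof. by apply: ereal_sup_ubound; exists k. Qed.

Let F_le t w : 0 <= t <= V -> ((F t w)%:E <= S w)%E.
Proof.
move=> /andP[t0 tV].
have [[r tr]|/forallNP tq] := pselect (exists r : rat, t = ratr r).
  have [k <-] : exists k, q k = t by rewrite tr; apply: q_rat; rewrite -tr t0.
  exact: F_le_S.
have {}tq r : t != ratr r by apply/eqP; exact: tq.
have tgt0 : 0 < t.
  by rewrite lt_neqAle t0 eq_sym andbT; have := tq 0; rewrite rmorph0.
have [tV'|tV'] := eqVneq t V.
  by have [k qk] := q_V; rewrite tV' -qk; exact: F_le_S.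
have {tV'}tV : t < V by rewrite lt_neqAle tV'.
have [r r0 hr] := truncn_locally_constant n tgt0 tq.
have mitv (i : interval R) : measurable ([set` i] : set (measurableTypeR R)).
  exact: measurable_itv.
have [int|nint] := pselect (leb.-integrable `[0, t * mu] (EFin \o (Z^~ w))).
  have tmu0 : 0 < t * mu by rewrite mulr_gt0.
  have /cvgrPdist_lt cI := parameterized_integral_cvg_at_left tmu0 int.
  apply/lee_addgt0Pr => e e0.
  have [r' /= r'0 hr'] := cI _ e0.
  (* A rational between [lo] and [t] is admissible, has the same truncation [[nt]], and changes the
     integral by less than [e]. *)
  pose lo := Num.max 0 (Num.max (t - r) (t - r' / mu)).
  have lot : lo < t.
    by rewrite !gt_max tgt0/= !ltrBlDr !ltrDl r0 divr_gt0.
  have [p] := rat_in_itvoo lot.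
  rewrite in_itv/= !gt_max -!andbA => /and4P[p0 pr pr' pt].
  have [k qk] : exists k, q k = ratr p by apply: q_rat; rewrite !ltW// (lt_trans pt).
  apply: (le_trans _ (leeD (F_le_S k w) (le_refl _))).
  rewrite qk -EFinD lee_fin /F hr; last first.
    by rewrite ltr_norml; lra.
  have h1 : `|\int[leb]_(s in `[0, t * mu]) Z s w - \int[leb]_(s in `[0, ratr p * mu]) Z s w| < e.
    apply: hr' => /=; last by rewrite ltr_pM2r.
    rewrite ger0_norm ?subr_ge0 ?ler_pM2r// ?ltW//.
    by rewrite -mulrBl -ltr_pdivlMr//; lra.
  set A := Delta * _; set I := Rintegral _ _ _ in h1 *; set J := Rintegral _ _ _ in h1 *.
  have -> : A - I = (A - J) - (I - J) by ring.
  by apply: (le_trans (ler_normB _ _)); rewrite lerD2l ltW.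
pose hi := Num.min V (t + r).
have thi : t < hi by rewrite lt_min tV ltrDl.
have [p] := rat_in_itvoo thi.
rewrite in_itv/= lt_min => /and3P[tp pV pr].
have [k qk] : exists k, q k = ratr p by apply: q_rat; rewrite !ltW// (lt_trans tgt0).
apply: le_trans (F_le_S k w); rewrite qk /F hr; last first.
  by rewrite ltr_norml; lra.
have nint' : ~ leb.-integrable `[0, ratr p * mu] (EFin \o (Z^~ w)).
  move=> int; apply: nint; apply: integrableS int => //.
  by apply: subset_itvl; rewrite bnd_simp ler_pM2r// ltW.
have mZw (i : interval R) :
    measurable_fun ([set` i] : set (measurableTypeR R)) (Z^~ w).
  by apply: measurable_funTS; exact: mpath.
by rewrite (Rintegral_nonintegrable (mitv _) (mZw _) nint)
  (Rintegral_nonintegrable (mitv _) (mZw _) nint').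
Qed.

Lemma measurable_sup_error : measurable_fun setT (fun w => ereal_sup
  [set `|Delta * (\sum_(0 <= k < Num.truncn (n%:R * t)) Z (k%:R * Delta) w) -
    \int[leb]_(s in `[0, t * mu]) Z s w|%:E | t in `[0, V]]).
Proof.
(* At index 0, [esups] is the supremum of the whole sequence, and countable suprema preserve
   measurability. *)
rewrite (_ : (fun w => _) = (fun w => esups (fun k => (F (q k) w)%:E) 0)); last first.
  apply/funext => w; rewrite /esups/=; apply/eqP; rewrite eq_le; apply/andP; split.
    apply: ge_ereal_sup => _ [t /= + <-]; rewrite in_itv/= => tV.
    apply: (le_trans (F_le w tV)); apply: ereal_sup_le => _ [k _ <-].
    by exists k.
  apply: ereal_sup_le => _ [k _ <-].
  by exists (q k) => //=; rewrite in_itv/= q_itv.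
apply: (@measurable_fun_esups _ _ _ setT (fun k w => (F (q k) w)%:E)) => k.
apply/measurable_EFinP; apply: measurableT_comp => //.
apply: measurable_funB; last first.
  by apply: measurable_Rintegral_section => //; exact: measurable_itv.
apply: measurable_funM => //; apply: measurable_sum => j.
exact: measurableT_comp mZ (@pair1_measurable _ _ _ _ _).
Qed.

End measurable_supremum.

(** * Convergence in probability *)

Section centered_moments.
Variables (R : realType) (d : measure_display) (T : measurableType d).
Variable P : probability T R.

Lemma integrable_of_second_moment (U : T -> R) (c : R) : measurable_fun setT U ->
  (\int[P]_w (U w ^+ 2)%:E <= c%:E)%E -> P.-integrable setT (EFin \o U).
Proof.
move=> mU Uc.
have i2 : P.-integrable setT (EFin \o (fun w => U w ^+ 2)).
  apply/integrableP; split; first by apply/measurable_EFinP; exact: measurable_funX.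
  under eq_integral do rewrite /= ger0_norm ?sqr_ge0//.
  by rewrite (le_lt_trans Uc)// ltry.
have i1 : P.-integrable setT (EFin \o (cst 1 : T -> R)).
  exact: finite_measure_integrable_cst.
apply: le_integrable (integrableD measurableT i1 i2) => //; first exact/measurable_EFinP.
move=> w _ /=; rewrite lee_fin (le_trans (norm_le_sqr (U w) ltr01))//.
by rewrite invr1 mul1r ler_norm.
Qed.

(** The variance is the second moment minus the squared mean. *)
Lemma centered_second_moment_le (U : T -> R) (c : R) : measurable_fun setT U ->
  (\int[P]_w (U w ^+ 2)%:E <= c%:E)%E ->
  (\int[P]_w ((U w - fine ('E_P[U])%E) ^+ 2)%:E <= c%:E)%E.
Proof.
move=> mU Uc.
have i1 := integrable_of_second_moment mU Uc.
have i2 : P.-integrable setT (EFin \o (U * U)).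
  apply/integrableP; split; first by apply/measurable_EFinP; exact: measurable_funM.
  under eq_integral do rewrite /= -expr2 ger0_norm ?sqr_ge0//.
  by rewrite (le_lt_trans Uc)// ltry.
have U1 : U \in Lfun P 1 by exact/Lfun1_integrable.
have E2 : ('E_P[U * U] = \int[P]_w (U w ^+ 2)%:E)%E.
  by rewrite unlock; apply: eq_integral => w _; rewrite expr2.
have -> : (\int[P]_w ((U w - fine ('E_P[U])%E) ^+ 2)%:E)%E = covariance P U U.
  rewrite [in RHS]unlock; set m := fine _; rewrite unlock; apply: eq_integral => w _.
  by rewrite expr2.
rewrite covarianceE//; last exact/Lfun1_integrable.
rewrite E2 (le_trans _ Uc)//.
rewrite -(fineK (expectation_fin_num U1)) -EFinM leeBlDr//.
by rewrite leeDl// lee_fin -expr2 sqr_ge0.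
Qed.

Variable X : R -> T -> R.
Hypothesis mX : measurable_fun [set: R * T] (fun p : R * T => X p.1 p.2).

(** The point is that the mean is measurable in time; this follows from Tonelli's theorem for the
    positive and negative parts of [X]. *)
Lemma measurable_centered :
  measurable_fun [set: R * T] (fun p : R * T => centered P X p.1 p.2).
Proof.
apply: measurable_funB => //.
apply: (measurableT_comp (@fine_measurable R setT measurableT)).
rewrite unlock.
apply: (@measurableT_comp _ _ _ _ _ _
  (fun t : R => \int[P]_w (X t w)%:E)%E _ fst) => //.
under eq_fun do rewrite integralE.
apply: emeasurable_funB.
- have mp : measurable_fun setT (fun p : measurableTypeR R * T => (Num.max (X p.1 p.2) 0)%:E).
    by apply/measurable_EFinP; exact: measurable_maxr.
  have p0 (p : R * T) : (0 <= (Num.max (X p.1 p.2) 0)%:E)%E.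
    by rewrite lee_fin le_max lexx orbT.
  have := @measurable_fun_fubini_tonelli_F _ _ (measurableTypeR R) T R P _ mp p0.
  apply: eq_measurable_fun => t _; apply: eq_integral => w _.
  by rewrite funeposE EFin_max.
- have mp : measurable_fun setT (fun p : measurableTypeR R * T => (Num.max (- X p.1 p.2) 0)%:E).
    by apply/measurable_EFinP; apply: measurable_maxr => //; exact: measurableT_comp.
  have p0 (p : R * T) : (0 <= (Num.max (- X p.1 p.2) 0)%:E)%E.
    by rewrite lee_fin le_max lexx orbT.
  have := @measurable_fun_fubini_tonelli_F _ _ (measurableTypeR R) T R P _ mp p0.
  apply: eq_measurable_fun => t _; apply: eq_integral => w _.
  by rewrite funenegE EFin_max.
Qed.

Let mXt t : measurable_fun setT (X t).
Proof. exact: measurable_process_time mX t. Qed.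

Lemma centered_second_moment (C : R) :
  (forall t, \int[P]_w (X t w ^+ 2)%:E <= C%:E)%E ->
  forall t, (\int[P]_w (centered P X t w ^+ 2)%:E <= C%:E)%E.
Proof. by move=> XC t; exact: centered_second_moment_le. Qed.

(** The increment of the centered process is the centering of [X t - X s], by linearity of the
    expectation on integrable variables. *)
Lemma centered_increment (C C' : R) :
  (forall t, \int[P]_w (X t w ^+ 2)%:E <= C%:E)%E ->
  (forall s t, `|t - s| <= 1 ->
    (\int[P]_w ((X t w - X s w) ^+ 2)%:E <= (C' * `|t - s|)%:E)%E) ->
  forall s t, `|t - s| <= 1 ->
    (\int[P]_w ((centered P X t w - centered P X s w) ^+ 2)%:E <= (C' * `|t - s|)%:E)%E.
Proof.
move=> XC Xinc s t st1.
have mU : measurable_fun setT (X t \- X s) by exact: measurable_funB.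
have := centered_second_moment_le mU (Xinc s t st1).
have L1 u : X u \in Lfun P 1.
  by apply/Lfun1_integrable; exact: integrable_of_second_moment (XC u).
rewrite expectationB// fineB ?expectation_fin_num//.
congr (_ <= _)%E; apply: eq_integral => w _; congr EFin.
by rewrite /centered/=; ring.
Qed.

End centered_moments.

Lemma cvg_ge0_eventually_le (R : realType) (u : nat -> \bar R) :
  (forall n, 0 <= u n)%E ->
  (forall e : R, 0 < e -> \forall n \near \oo, (u n <= e%:E)%E) ->
  u n @[n --> \oo] --> 0%E.
Proof.
move=> u0 ue; apply/fine_cvgP; split.
  near=> n; rewrite ge0_fin_numE//.
  apply: (@le_lt_trans _ _ 1%:E); last exact: ltry.
  by near: n; exact: ue.
apply/cvgrPdist_le => e e0; near=> n.
have un : (u n <= e%:E)%E by near: n; exact: ue.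
rewrite sub0r normrN ger0_norm ?fine_ge0//=.
rewrite -lee_fin fineK// ge0_fin_numE//; exact: le_lt_trans un (ltry _).
Unshelve. all: by end_near. Qed.

Section uniform_riemann_convergence.
Variables (R : realType) (d : measure_display) (T : measurableType d).
Variables (P : probability T R) (Z : R -> T -> R) (C : R).
Local Notation leb := (@lebesgue_measure R).
Hypothesis mZ : measurable_fun [set: R * T] (fun p : R * T => Z p.1 p.2).
Hypothesis C0 : 0 <= C.
Hypothesis Z2 : forall t, (\int[P]_w (Z t w ^+ 2)%:E <= C%:E)%E.
Hypothesis Zinc : forall s t, `|t - s| <= 1 ->
  (\int[P]_w ((Z t w - Z s w) ^+ 2)%:E <= (C * `|t - s|)%:E)%E.
Variables (Delta : nat -> R) (mu V : R).
Hypothesis D0 : forall n, 0 <= Delta n.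
Hypothesis cD : Delta n @[n --> \oo] --> 0.
Hypothesis mu0 : 0 < mu.
Hypothesis cnD : n%:R * Delta n @[n --> \oo] --> mu.
Hypothesis V0 : 0 < V.

Let Y (n : nat) (w : T) : \bar R := ereal_sup
  [set `|Delta n * (\sum_(0 <= k < Num.truncn (n%:R * t)) Z (k%:R * Delta n) w) -
    \int[leb]_(s in `[0, t * mu]) Z s w|%:E | t in `[0, V]].

(** With [j = [nt]], [j Delta - t mu = t (n Delta - mu) - (n t - j) Delta], where [t <= V] and
    [0 <= n t - j <= 1]. *)
Let delta (n : nat) : R := V * `|n%:R * Delta n - mu| + Delta n.
(** A horizon containing both [t mu] and the grid up to [[nV] Delta] as soon as
    [n Delta <= mu + 1]. *)
Let K : R := V * (mu + 1).

Lemma sup_error_le (M : R) (n : nat) (w : T) : 0 < M -> n%:R * Delta n <= mu + 1 ->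
  (Y n w <= error_bound Z (Delta n) K M (delta n) (Num.truncn (n%:R * V)) w)%E.
Proof.
move=> M0 nDmu; apply: ge_ereal_sup => _ [t /= + <-].
rewrite in_itv/= => /andP[t0 tV].
have nt0 : 0 <= n%:R * t by rewrite mulr_ge0.
have nV0 : 0 <= n%:R * V by rewrite mulr_ge0// ltW.
apply: path_error_le => //.
- apply: (@le_trans _ _ (n%:R * V * Delta n)).
    by rewrite ler_wpM2r// truncn_le.
  by rewrite /K mulrAC mulrC ler_pM2l.
- by apply: le_truncn; rewrite ler_wpM2l.
- rewrite mulr_ge0 ?(ltW mu0)//= /K; apply: ler_pM => //; first exact: ltW.
  by rewrite lerDl.
have /andP[lo hi] := truncn_itv nt0.
set j := Num.truncn _ in lo hi *.
have -> : j%:R * Delta n - t * mu =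
    t * (n%:R * Delta n - mu) - (n%:R * t - j%:R) * Delta n by ring.
apply: (le_trans (ler_normB _ _)); rewrite /delta !normrM lerD//.
  by rewrite ger0_norm// ler_wpM2r.
rewrite (ger0_norm (D0 n)) ler_piMl// ger0_norm ?subr_ge0// lerBlDl.
by rewrite -natr1 in hi; rewrite ltW.
Qed.

Lemma cvg_in_probability_riemann_sup : cvg_in_probability P Y 0.
Proof.
split; first by move=> n; exact: measurable_sup_error.
move=> e e0; apply: cvg_ge0_eventually_le => [n|eps eps0]; first exact: measure_ge0.
have K0 : 0 <= K by rewrite /K mulr_ge0 ?ltW// addr_gt0.
have cdelta : delta n @[n --> \oo] --> 0.
  rewrite /delta -[0](addr0 0) -[X in X + _](mulr0 V).
  apply: cvgD => //; apply: cvgMl_tmp; rewrite -(normr0 R).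
  by apply: cvg_norm; rewrite -(subrr mu); apply: cvgB => //; exact: cvg_cst.
(* [M] is fixed before [n], so that the terms of the expected bound free of [n], namely
   [K (1 + C) / M], use up at most half of [e * eps]. The remaining terms tend to 0 for this [M]. *)
pose M : R := 2 * (K * (1 + C)) / (e * eps) + 1.
have M0 : 0 < M.
  by rewrite ltr_wpDl// divr_ge0// ?mulr_ge0// ?addr_ge0// ltW.
have MK : M^-1 * (K * (1 + C)) <= e * eps / 2.
  rewrite ler_pdivrMl// /M mulrDl mul1r.
  have ee : e * eps != 0 by rewrite mulf_neq0// gt_eqF.
  have -> : 2 * (K * (1 + C)) / (e * eps) * (e * eps / 2) = K * (1 + C).
    by field; rewrite !gt_eqF.
  by rewrite lerDl divr_ge0// mulr_ge0// ltW.
have csmall : K * (M * (C * Delta n)) + M * delta n @[n --> \oo] --> 0.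
  rewrite -[0](addr0 0); apply: cvgD.
    rewrite -[X in _ --> X](mulr0 K); apply: cvgMl_tmp.
    rewrite -[X in _ --> X](mulr0 M); apply: cvgMl_tmp.
    by rewrite -[X in _ --> X](mulr0 C); apply: cvgMl_tmp.
  by rewrite -[X in _ --> X](mulr0 M); apply: cvgMl_tmp.
near=> n.
have D1 : Delta n <= 1.
  by near: n; apply: (cvgr_le _ cD); exact: ltr01.
have nD : n%:R * Delta n <= mu + 1.
  by near: n; apply: (cvgr_le _ cnD); rewrite ltrDl.
have small : K * (M * (C * Delta n)) + M * delta n <= e * eps / 2.
  by near: n; apply: (cvgr_le _ csmall); rewrite divr_gt0// mulr_gt0.
pose B := error_bound Z (Delta n) K M (delta n) (Num.truncn (n%:R * V)).
have mB : measurable_fun setT B by exact: measurable_error_bound.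
have delta0 : 0 <= delta n by rewrite /delta addr_ge0// mulr_ge0// ltW.
have B0 w : (0 <= B w)%E.
  rewrite /B /error_bound !adde_ge0 ?riemann_error_ge0//.
    by rewrite lee_fin mulr_ge0// ltW.
  by rewrite mule_ge0 ?path_energy_ge0// lee_fin invr_ge0 ltW.
have Y0 w : (0 <= Y n w)%E.
  have VV : `[0, V]%classic V by rewrite /= in_itv/= lexx ltW.
  apply: le_trans (ereal_sup_ubound (imageP _ VV)).
  by rewrite lee_fin.
have intB : (\int[P]_w B w <= (e * eps)%:E)%E.
  have NK : (Num.truncn (n%:R * V))%:R * Delta n <= K.
    apply: (@le_trans _ _ (n%:R * V * Delta n)).
      by rewrite ler_wpM2r// truncn_le// mulr_ge0// ltW.
    by rewrite /K mulrAC mulrC ler_pM2l.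
  apply: le_trans (integral_error_bound_le mZ C0 Z2 Zinc M0 _ delta0 K0 NK) _.
    by rewrite D0.
  by rewrite lee_fin; lra.
(* Markov's inequality for the dominating variable, whose event contains the one for the
   supremum. *)
have markovB : (e%:E * P [set w | (e%:E <= B w)%E] <= \int[P]_w B w)%E.
  have := @le_integral_abse _ _ _ P setT measurableT B e mB e0.
  rewrite setTI; under eq_integral do rewrite gee0_abs//.
  apply: le_trans; rewrite le_eqVlt; apply/orP; left; apply/eqP.
  by congr (_ * P _)%E; apply/seteqP; split => w /=; rewrite gee0_abs.
have mYn : measurable_fun setT (Y n) by exact: measurable_sup_error.
apply: (@le_trans _ _ (P [set w | (e%:E <= B w)%E])).
  apply: le_measure; rewrite ?inE.
  - rewrite -[X in measurable X]setTI.
    apply: measurable_lte => //; apply: measurableT_comp => //.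
    exact: emeasurable_funB.
  - rewrite -[X in measurable X]setTI; exact: measurable_lee.
  move=> w /=; rewrite sube0 gee0_abs// => /ltW eY.
  by apply: (le_trans eY); exact: sup_error_le.
rewrite -(@lee_pmul2l _ e%:E)//.
by apply: (le_trans markovB); rewrite -EFinM.
Unshelve. all: by end_near. Qed.

End uniform_riemann_convergence.

Unset Implicit Arguments.

Theorem proposition1 (R : realType) (d : measure_display) (T : measurableType d)
  (P : probability T R)
  (gamma b : R) (nu : {measure set R -> \bar R})
  (L : set (R * R) -> {RV P >-> R})
  (d' : measure_display) (T' : measurableType d') (P' : probability T' R)
  (L' : {RV P' >-> R})
  (a : R -> R) (X : R -> T -> R) (Delta : nat -> R) (mu : R) :
  levy_basis gamma b nu L ->
  is_seed gamma b nu L' ->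
  ('E_P'[fun w => (`|L' w| ^+ 2)%R] < +oo)%E ->
  trawl_function a ->
  trawl_process L a X ->
  nonincreasing_seq Delta ->
  Delta n @[n --> \oo] --> 0 ->
  0 < mu ->
  n%:R * Delta n @[n --> \oo] --> mu ->
  forall V : R, 0 < V ->
    cvg_in_probability P
      (fun n w => ereal_sup
        [set `| Delta n * centered_sum P X Delta n t w
                - \int[lebesgue_measure]_(s in `[0, t * mu]) centered P X s w |%:E
        | t in `[0, V]])
      0.
Proof.
move=> lL sL' L'oo ta tX ndD cD mu0 cnD V V0.
(* A nonincreasing sequence stays above its limit. *)
have D0 n : 0 <= Delta n.
  have := nonincreasing_cvgn_ge ndD (cvgP _ cD) n.
  by rewrite (cvg_lim _ cD).
have [C1 C10 X2] := trawl_process_second_moment lL sL' L'oo ta tX.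
have [C2 C20 Xinc] := trawl_process_increment lL sL' L'oo ta tX.
(* The sum of the two constants serves for both the second moments and the increments. *)
apply: (@cvg_in_probability_riemann_sup _ _ _ P (centered P X) (C1 + C2)) => //.
- exact: measurable_centered tX.1.
- by rewrite addr_ge0.
- move=> t; apply: (le_trans (centered_second_moment tX.1 X2 t)).
  by rewrite lee_fin lerDl.
- move=> s t st; apply: (le_trans (centered_increment tX.1 X2 Xinc st)).
  by rewrite lee_fin ler_wpM2r// lerDr.
Qed.
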